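(* Let $(X,\mu)$ be a standard atomless probability space and let $T\in\mathrm{Aut}(X,[\mu])$ be ergodic. The index map $$I:[T]_{\mathrm{com}}\to\mathbb Z$$ is a quasi-isometry.
   Context: $\mathrm{Aut}(X,[\mu])$ is the group of measurable bijections $T:X\to X$ such that $T_*\mu$ and $\mu$ have the same null sets, two such maps being identified if they agree almost everywhere. $T$ is ergodic if every $T$-invariant Borel set is null or conull; $T$ is aperiodic if almost every $T$-orbit is infinite (ergodic transformations are aperiodic since $\mu$ is atomless). Let $T\in\mathrm{Aut}(X,[\mu])$ be aperiodic. The full group $[T]$ is the group of $S\in\mathrm{Aut}(X,[\mu])$ such that for a.e. $x$, $S(x)=T^{c_S(x)}(x)$ for some integer $c_S(x)$; the a.e. uniquely defined measurable map $c_S:X\to\mathbb Z$ is the cocycle of $S$. Let $\mathrm{Sym}(\mathbb Z,\mathbb N)$ be the group of permutations $\sigma$ of $\mathbb Z$ with $|\sigma(\mathbb N)\triangle\mathbb N|<\infty$, with the group topology for which a basis of neighborhoods of the identity is given by the pointwise stabilizers of finite subsets of $\mathrm{Comm}(\mathbb N)=\{M\subset\mathbb Z: |M\triangle\mathbb N|<\infty\}$. For $S\in[T]$, $x\in X$, define the permutation $\Phi(S)(x)$ of $\mathbb Z$ by $\Phi(S)(x)(n)=n+c_S(T^n(x))$. The commensurating full group is $$[T]_{\mathrm{com}}=\{S\in[T]:\ \Phi(S)(x)\in\mathrm{Sym}(\mathbb Z,\mathbb N)\text{ for a.e. }x\},$$ endowed with the topology pulled back by $\Phi$ from $\mathrm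 L^0(X,\mu,\mathrm{Sym}(\mathbb Z,\mathbb N))$, the group (under pointwise multiplication) of measurable maps $X\to\mathrm{Sym}(\mathbb Z,\mathbb N)$ modulo a.e. equality, with the topology of convergence in measure. With this topology it is a Polish group. Index map: for $\sigma\in\mathrm{Sym}(\mathbb Z,\mathbb N)$ put $I(\sigma)=|\mathbb N\setminus\sigma(\mathbb N)|-|\sigma(\mathbb N)\setminus\mathbb N|$. If $T$ is ergodic and $S\in[T]_{\mathrm{com}}$, the integer $I(\Phi(S)(x))$ is the same for a.e. $x$; this common value is denoted $I(S)$, and $I:[T]_{\mathrm{com}}\to\mathbb Z$ is a continuous homomorphism. Quasi-isometry for Polish groups: a compatible left-invariant metric $d$ on a Polish group $G$ is maximal if for any other compatible left-invariant metric $d'$ on $G$ there is a constant $C>0$ with $d'(g,h)\le C\,d(g,h)+C$ for all $g,h\in G$. All maximal metrics are quasi-isometric to one another. That a map from $G$ to $\mathbb Z$ (with its usual metric) is a quasi-isometry means that $G$ admits a maximal metric and that the map is a quasi-isometry in the usual sense for one (equivalently, any) maximal metric on $G$. *)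

(* Defs.v *)
From HB Require Import structures.
From mathcomp Require Import all_boot all_order all_algebra finmap generic_quotient.
From mathcomp Require Import all_classical all_reals all_analysis.

Set Implicit Arguments.
Unset Strict Implicit.
Unset Printing Implicit Defensive.

Import Order.TTheory GRing.Theory Num.Theory.

Local Open Scope classical_set_scope.
Local Open Scope ring_scope.

Section StandardAtomless.
Context (R : realType) (d : measure_display) (X : measurableType d).

(* The sigma-algebra of X is the Borel sigma-algebra of a Polish topology,
   transported along the bijection f. *)
Definition standard_borel : Prop :=
  exists (Y : completePseudoMetricType R) (f : X -> Y),
    [/\ hausdorff_space Y, @second_countable Y, bijective f &
        forall A : set X,
          measurable A <-> exists2 B : set Y, <<s @open Y >> B & A = f @^-1` B].

Definition atomless (mu : probability X R) : Prop :=
  forall A : set X, measurable A -> (0 < mu A)%E ->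
    exists B : set X, [/\ measurable B, B `<=` A, (0 < mu B)%E & (mu B < mu A)%E].

End StandardAtomless.

Section Aut.
Context (R : realType) (d : measure_display) (X : measurableType d).
Variable mu : probability X R.

(* A measurable bijection is understood as an isomorphism of measurable spaces;
   on a standard Borel space measurability of the inverse is automatic
   (Lusin-Souslin). *)
Record nsbij := NSBij {
  ns_fun :> X -> X;
  ns_inv : X -> X;
  ns_funK : cancel ns_fun ns_inv;
  ns_invK : cancel ns_inv ns_fun;
  ns_meas : measurable_fun setT ns_fun;
  ns_inv_meas : measurable_fun setT ns_inv;
  ns_null : forall A : set X, measurable A -> mu (ns_fun @^-1` A) = 0%E <-> mu A = 0%E
}.

HB.instance Definition _ := gen_eqMixin nsbij.
HB.instance Definition _ := gen_choiceMixin nsbij.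

Definition ns_eq (f g : nsbij) : bool := `[< {ae mu, forall x, f x = g x} >].

Lemma ns_eq_refl : reflexive ns_eq.
Proof. by move=> f; apply/asboolP; apply: aeW. Qed.

Lemma ns_eq_sym : symmetric ns_eq.
Proof.
suff H f g : ns_eq f g -> ns_eq g f by move=> f g; apply/idP/idP => /H.
by move=> /asboolP fg; apply/asboolP; apply: filterS fg => x.
Qed.

Lemma ns_eq_trans : transitive ns_eq.
Proof.
move=> g f h /asboolP fg /asboolP gh; apply/asboolP.
by apply: filterS2 fg gh => x -> .
Qed.

Canonical ns_eq_equiv := EquivRel ns_eq ns_eq_refl ns_eq_sym ns_eq_trans.

Local Open Scope quotient_scope.

Definition Aut : Type := {eq_quot ns_eq}.
HB.instance Definition _ := Choice.on Aut.
HB.instance Definition _ := EqQuotient.on Aut.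

Lemma ns_preimage_measurable (f : nsbij) (A : set X) :
  measurable A -> measurable (f @^-1` A).
Proof. by move=> mA; rewrite -[_ @^-1` _]setTI; exact: (@ns_meas f). Qed.

Lemma ns_inv_preimage_measurable (f : nsbij) (A : set X) :
  measurable A -> measurable (ns_inv f @^-1` A).
Proof. by move=> mA; rewrite -[_ @^-1` _]setTI; exact: (@ns_inv_meas f). Qed.

Lemma ns_ae (f : nsbij) (P : X -> Prop) :
  {ae mu, forall x, P x} -> {ae mu, forall x, P (f x)}.
Proof.
move=> [B [mB B0 PB]]; exists (f @^-1` B); split.
- exact: ns_preimage_measurable.
- exact/ns_null.
- by move=> x /= Pfx; apply: PB.
Qed.

Lemma ns_id_null (A : set X) :
  measurable A -> mu (idfun @^-1` A) = 0%E <-> mu A = 0%E.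
Proof. by []. Qed.

Definition ns_id : nsbij :=
  NSBij (fun=> erefl) (fun=> erefl) (@measurable_id _ X setT)
    (@measurable_id _ X setT) ns_id_null.

Lemma ns_sym_null (f : nsbij) (A : set X) :
  measurable A -> mu (ns_inv f @^-1` A) = 0%E <-> mu A = 0%E.
Proof.
move=> mA.
apply: iff_trans (iff_sym (@ns_null f _ (ns_inv_preimage_measurable f mA))) _.
by rewrite (_ : f @^-1` _ = A)//; apply/seteqP; split=> x /=; rewrite ns_funK.
Qed.

Definition ns_sym (f : nsbij) : nsbij :=
  NSBij (@ns_invK f) (@ns_funK f) (@ns_inv_meas f) (@ns_meas f) (@ns_sym_null f).

Lemma ns_comp_null (f g : nsbij) (A : set X) :
  measurable A -> mu ((f \o g) @^-1` A) = 0%E <-> mu A = 0%E.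
Proof.
move=> mA; apply: iff_trans (@ns_null f A mA).
exact: (@ns_null g _ (ns_preimage_measurable f mA)).
Qed.

Definition ns_comp (f g : nsbij) : nsbij :=
  NSBij (can_comp (@ns_funK f) (@ns_funK g)) (can_comp (@ns_invK g) (@ns_invK f))
    (measurableT_comp (@ns_meas f) (@ns_meas g))
    (measurableT_comp (@ns_inv_meas g) (@ns_inv_meas f)) (@ns_comp_null f g).

Definition aut1 : Aut := \pi_Aut ns_id.
Definition autM (S T : Aut) : Aut := \pi_Aut (ns_comp (repr S) (repr T)).
Definition autV (S : Aut) : Aut := \pi_Aut (ns_sym (repr S)).

Lemma aut_piP (f g : nsbij) :
  {ae mu, forall x, f x = g x} <-> \pi_Aut f = \pi_Aut g.
Proof.
split=> [fg|/eqmodP/asboolP//].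
by apply/eqmodP/asboolP.
Qed.

Lemma aut_repr (f : nsbij) : {ae mu, forall x, repr (\pi_Aut f) x = f x}.
Proof. by apply/aut_piP; rewrite reprK. Qed.

Lemma autM_pi (f g : nsbij) : autM (\pi_Aut f) (\pi_Aut g) = \pi_Aut (ns_comp f g).
Proof.
apply/aut_piP; have := ns_ae (repr (\pi_Aut g)) (aut_repr f).
by apply: filterS2 (aut_repr g) => x /= gx ->; rewrite gx.
Qed.

Lemma aut_pi_repr (S : Aut) : exists f : nsbij, S = \pi_Aut f.
Proof. by exists (repr S); rewrite reprK. Qed.

Lemma autMA : associative autM.
Proof.
move=> S T U.
have [f ->] := aut_pi_repr S; have [g ->] := aut_pi_repr T.
have [h ->] := aut_pi_repr U.
by rewrite !autM_pi; apply/aut_piP; apply: aeW.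
Qed.

Lemma aut1M : left_id aut1 autM.
Proof.
move=> S; have [f ->] := aut_pi_repr S.
by rewrite autM_pi; apply/aut_piP; apply: aeW.
Qed.

Lemma autM1 : right_id aut1 autM.
Proof.
move=> S; have [f ->] := aut_pi_repr S.
by rewrite autM_pi; apply/aut_piP; apply: aeW.
Qed.

Lemma autVM : left_inverse aut1 autV autM.
Proof.
move=> S; transitivity (autM (autV S) (\pi_Aut (repr S))); first by rewrite reprK.
by rewrite autM_pi; apply/aut_piP; apply: aeW => x /=; rewrite ns_funK.
Qed.

Lemma autMV : right_inverse aut1 autV autM.
Proof.
move=> S; transitivity (autM (\pi_Aut (repr S)) (autV S)); first by rewrite reprK.
by rewrite autM_pi; apply/aut_piP; apply: aeW => x /=; rewrite ns_invK.
Qed.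

HB.instance Definition _ := isGroup.Build Aut autMA aut1M autM1 autVM autMV.

Definition aut_fun (S : Aut) : X -> X := repr S.

Definition aut_iter (T : Aut) (n : int) : X -> X :=
  match n with
  | Posz k => iter k (repr T)
  | Negz k => iter k.+1 (ns_inv (repr T))
  end.

Definition ergodic (T : Aut) : Prop :=
  forall A : set X, measurable A -> aut_fun T @^-1` A = A ->
    mu A = 0%E \/ mu (~` A) = 0%E.

Definition full_group (T : Aut) : set Aut :=
  [set S | {ae mu, forall x, exists n : int, aut_fun S x = aut_iter T n x}].

(* Where n is not unique (a null set when T is aperiodic), some n is chosen. *)
Definition cocycle (T S : Aut) (x : X) : int :=
  xget 0 [set n : int | aut_fun S x = aut_iter T n x].

Definition Phi_fun (T S : Aut) (x : X) (n : int) : int :=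
  n + cocycle T S (aut_iter T n x).

End Aut.

Definition natZ : set int := [set n | 0 <= n].

Definition Comm : set (set int) := [set M | finite_set (M `+` natZ)].

Definition is_symZN (s : int -> int) : Prop :=
  bijective s /\ Comm (s @` natZ).

Record symZN := SymZN { sym_fun :> int -> int; symP : is_symZN sym_fun }.

HB.instance Definition _ := gen_eqMixin symZN.
HB.instance Definition _ := gen_choiceMixin symZN.

Lemma symZN_eq (s t : symZN) : (forall n, s n = t n) -> s = t.
Proof.
case: s t => s sP [t tP] /= /funext st; rewrite -st in tP *.
by rewrite (Prop_irrelevance sP tP).
Qed.

Definition fun_inv (s : int -> int) (m : int) : int := xget 0 [set n | s n = m].

Lemma fun_invK (s : int -> int) : bijective s -> cancel s (fun_inv s).
Proof.
by move=> bs n; apply: xget_unique => // m /(bij_inj bs).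
Qed.

Lemma fun_Kinv (s : int -> int) : bijective s -> cancel (fun_inv s) s.
Proof.
move=> [t st ts] m; rewrite /fun_inv.
by apply: (@xgetPex _ _ [set n | s n = m]); exists (t m); apply: ts.
Qed.

Lemma is_symZN_id : is_symZN id.
Proof. by split; [exists id | rewrite /Comm/= image_id setYK; exact: finite_set0]. Qed.

Lemma image_setY (s : int -> int) (A B : set int) : injective s ->
  s @` (A `+` B) = s @` A `+` s @` B.
Proof.
move=> si; apply/seteqP; split=> [_ [x [[Ax Bx]|[Bx Ax]] <-]|x].
- by left; split; [exists x|move=> [y By /si yx]; apply: Bx; rewrite -yx].
- by right; split; [exists x|move=> [y By /si yx]; apply: Ax; rewrite -yx].
- case=> [[[y Ay <-] Bsy]|[[y By <-] Asy]]; exists y => //.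
  + by left; split=> // By; apply: Bsy; exists y.
  + by right; split=> // Ay; apply: Asy; exists y.
Qed.

Lemma Comm_image (s : int -> int) (A : set int) :
  is_symZN s -> Comm A -> Comm (s @` A).
Proof.
move=> [/bij_inj si sN] AN; rewrite /Comm /=.
have -> : s @` A `+` natZ = s @` (A `+` natZ) `+` (s @` natZ `+` natZ).
  by rewrite image_setY// -setYA (setYA (s @` natZ)) setYK set0Y.
apply: (@sub_finite_set _ _ (s @` (A `+` natZ) `|` (s @` natZ `+` natZ))).
  by move=> x [[]|[]]; [left|right].
by rewrite finite_setU; split=> //; exact: finite_image.
Qed.

Lemma is_symZN_comp (s t : int -> int) :
  is_symZN s -> is_symZN t -> is_symZN (s \o t).
Proof.
move=> sP [bt tN]; split; first exact: bij_comp sP.1 bt.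
by rewrite -image_comp; exact: Comm_image.
Qed.

Lemma is_symZN_inv (s : int -> int) : is_symZN s -> is_symZN (fun_inv s).
Proof.
move=> [bs sN]; have bi : bijective (fun_inv s).
  by exists s; [exact: fun_Kinv|exact: fun_invK].
split=> //; rewrite /Comm /= setYC.
have -> : natZ `+` fun_inv s @` natZ = fun_inv s @` (s @` natZ `+` natZ).
  rewrite (image_setY _ _ (bij_inj bi)) image_comp.
  by rewrite (_ : _ \o _ = id) ?image_id//; apply/funext => n /=; rewrite fun_invK.
exact: finite_image.
Qed.

Definition sym1 : symZN := SymZN is_symZN_id.
Definition symM (s t : symZN) : symZN := SymZN (is_symZN_comp (symP s) (symP t)).
Definition symV (s : symZN) : symZN := SymZN (is_symZN_inv (symP s)).

Lemma symMA : associative symM. Proof. by move=> s t u; exact: symZN_eq. Qed.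
Lemma sym1M : left_id sym1 symM. Proof. by move=> s; exact: symZN_eq. Qed.
Lemma symM1 : right_id sym1 symM. Proof. by move=> s; exact: symZN_eq. Qed.
Lemma symVM : left_inverse sym1 symV symM.
Proof. by move=> s; apply: symZN_eq => n /=; rewrite fun_invK//; case: (symP s). Qed.
Lemma symMV : right_inverse sym1 symV symM.
Proof. by move=> s; apply: symZN_eq => n /=; rewrite fun_Kinv//; case: (symP s). Qed.

HB.instance Definition _ := isGroup.Build symZN symMA sym1M symM1 symVM symMV.

Definition sym_stab (F : set (set int)) : set symZN :=
  [set s | forall M, F M -> s @` M = M].

Lemma sym_stab1 F : sym_stab F 1%g.
Proof. by move=> M _; rewrite image_id. Qed.

Lemma sym_stabM F (s t : symZN) : sym_stab F s -> sym_stab F t -> sym_stab F (s * t)%g.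
Proof. by move=> sF tF M FM; rewrite /= -image_comp tF// sF. Qed.

Definition sym_nbhs (s : symZN) : set_system symZN :=
  [set A | exists F : set (set int),
     [/\ finite_set F, F `<=` Comm & forall t, sym_stab F (s^-1 * t)%g -> A t]].

HB.instance Definition _ := hasNbhs.Build symZN sym_nbhs.

Lemma sym_nbhs_filter (s : symZN) : ProperFilter (nbhs s).
Proof.
split; first by move=> [F [_ _ /(_ s)]]; rewrite mulVg; apply; exact: sym_stab1.
split.
- by exists set0; split.
- move=> A B [F [fF FC FA]] [G [fG GC GB]]; exists (F `|` G); split.
  + by rewrite finite_setU.
  + by move=> M [/FC|/GC].
  + move=> t st; split; [apply: FA|apply: GB] => M ?; apply: st; by [left|right].
- by move=> A B AB [F [fF FC FA]]; exists F; split=> // t /FA /AB.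
Qed.

Lemma sym_nbhs_singleton (s : symZN) (A : set symZN) : nbhs s A -> A s.
Proof. by move=> [F [_ _ FA]]; apply: FA; rewrite mulVg; exact: sym_stab1. Qed.

Lemma sym_nbhs_nbhs (s : symZN) (A : set symZN) : nbhs s A -> nbhs s (nbhs^~ A).
Proof.
move=> [F [fF FC FA]]; exists F; split=> // t st; exists F; split=> // u tu.
apply: FA; rewrite (_ : s^-1 * u = (s^-1 * t) * (t^-1 * u))%g.
  exact: sym_stabM.
by rewrite -mulgA mulVKg.
Qed.

HB.instance Definition _ := Nbhs_isNbhsTopological.Build symZN
  sym_nbhs_filter sym_nbhs_singleton sym_nbhs_nbhs.

Definition to_symZN (s : int -> int) : symZN :=
  if pselect (is_symZN s) is left sP then SymZN sP else 1%g.

Definition sym_index (s : int -> int) : int :=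
  #|` fset_set (natZ `\` s @` natZ)|%:Z - #|` fset_set (s @` natZ `\` natZ)|%:Z.

(* Maps are taken without a measurability requirement and before quotienting by
   a.e. equality. Restricted to measurable maps, the neighbourhoods below are
   those of convergence in measure; since the maps Phi T S used later are a.e.
   equal to measurable ones, the pullback along Phi is the pullback from the
   space of classes of measurable maps. *)
Definition L0sym (R : realType) (d : measure_display) (X : measurableType d)
  (mu : probability X R) : Type := X -> symZN.


Section L0.
Context (R : realType) (d : measure_display) (X : measurableType d).
Variable mu : probability X R.

HB.instance Definition _ := gen_eqMixin (L0sym mu).
HB.instance Definition _ := gen_choiceMixin (L0sym mu).

(* For A measurable up to a null set this says mu A < e. *)
Definition measure_lt (A : set X) (e : R) : Prop :=
  exists B : set X, [/\ measurable B, A `<=` B & (mu B < e%:E)%E].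

Definition L0_nbhs (f : (L0sym mu)) : set_system (L0sym mu) :=
  [set A | exists (U : set symZN) (e : R), [/\ nbhs (1%g : symZN) U, 0 < e &
     forall g : (L0sym mu), measure_lt [set x | ~ U ((f x)^-1 * g x)%g] e -> A g]].

HB.instance Definition _ := hasNbhs.Build (L0sym mu) L0_nbhs.

Lemma measure_lt0 (A : set X) (e : R) : A = set0 -> 0 < e -> measure_lt A e.
Proof. by move=> -> e0; exists set0; split=> //; rewrite measure0 lte_fin. Qed.

Lemma measure_ltS (A B : set X) (e e' : R) : A `<=` B -> e <= e' ->
  measure_lt B e -> measure_lt A e'.
Proof.
move=> AB ee' [C [mC BC Ce]]; exists C; split=> //; first exact: subset_trans BC.
by apply: (lt_le_trans Ce); rewrite lee_fin.
Qed.

Lemma L0_nbhs_refl (f : (L0sym mu)) (U : set symZN) (e : R) :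
  nbhs (1%g : symZN) U -> 0 < e -> measure_lt [set x | ~ U ((f x)^-1 * f x)%g] e.
Proof.
move=> U1 e0; apply: measure_lt0 => //; rewrite -subset0 => x /=; apply.
by rewrite mulVg; exact: nbhs_singleton.
Qed.

Lemma L0_nbhs_singleton (f : (L0sym mu)) (A : set (L0sym mu)) : nbhs f A -> A f.
Proof. by move=> [U [e [U1 e0 UA]]]; apply/UA/L0_nbhs_refl. Qed.

Lemma L0_nbhs_filter (f : (L0sym mu)) : ProperFilter (nbhs f).
Proof.
split; first by move=> /L0_nbhs_singleton.
split.
- by exists setT, 1; split=> //; exact: filterT.
- move=> A B [U [e [U1 e0 UA]]] [V [e' [V1 e0' VB]]].
  exists (U `&` V), (Num.min e e'); split.
  + exact: filterI.
  + by rewrite lt_min e0.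
  + move=> g fg; split; [apply: UA|apply: VB]; apply: measure_ltS fg.
    * by move=> x /= nU [].
    * by rewrite ge_min lexx.
    * by move=> x /= nV [].
    * by rewrite ge_min lexx orbT.
- by move=> A B AB [U [e [U1 e0 UA]]]; exists U, e; split=> // g /UA /AB.
Qed.

Lemma L0_nbhs_nbhs (f : (L0sym mu)) (A : set (L0sym mu)) : nbhs f A -> nbhs f (nbhs^~ A).
Proof.
move=> [U [e [[F [fF FC FU]] e0 UA]]].
exists (sym_stab F), e; split=> //.
  by exists F; split=> // t; rewrite invg1 mul1g.
move=> g [B [mB fgB Be]].
have Bfin : mu B \is a fin_num by apply: fin_num_measure.
exists (sym_stab F), (e - fine (mu B)); split.
- by exists F; split=> // t; rewrite invg1 mul1g.
- by rewrite subr_gt0 -lte_fin fineK.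
move=> h [C [mC ghC Ce]]; apply: UA; exists (B `|` C); split.
- exact: measurableU.
- move=> x /= nU; apply: contrapT => /not_orP[nB nC]; apply: nU; apply: FU.
  rewrite invg1 mul1g.
  rewrite (_ : (f x)^-1 * h x = ((f x)^-1 * g x) * ((g x)^-1 * h x))%g.
    by apply: sym_stabM; apply: contrapT => ?; [apply: nB; apply: fgB|apply: nC; apply: ghC].
  by rewrite -mulgA mulVKg.
- apply: (le_lt_trans (measureU2 _ mB mC)).
  by move: Ce; rewrite EFinB fineK// lteBrDr// addeC.
Qed.

HB.instance Definition _ := Nbhs_isNbhsTopological.Build (L0sym mu)
  L0_nbhs_filter L0_nbhs_singleton L0_nbhs_nbhs.

End L0.

Section CommensuratingFullGroup.
Context (R : realType) (d : measure_display) (X : measurableType d).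
Variable mu : probability X R.

Definition Phi (T S : Aut mu) : L0sym mu := fun x => to_symZN (Phi_fun T S x).

Definition com_full_group (T : Aut mu) : set (Aut mu) :=
  [set S | full_group T S /\ {ae mu, forall x, is_symZN (Phi_fun T S x)}].

Definition com_nbhs (T S : Aut mu) : set_system (Aut mu) :=
  within (com_full_group T) (nbhs (S : initial_topology (Phi T))).

(* The a.e. constant value of x |-> I(Phi(S)(x)). *)
Definition com_index (T S : Aut mu) : int :=
  xget 0 [set k : int | {ae mu, forall x, sym_index (Phi T S x) = k}].

End CommensuratingFullGroup.

(* In this section G is a subgroup of A, and tau g is, for g in G, the filter of
   neighbourhoods of g in G. *)
Section Metrics.
Context (R : realType) (A : groupType).
Variables (G : set A) (tau : A -> set_system A).

Definition metric_on (dist : A -> A -> R) : Prop :=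
  [/\ forall g h, G g -> G h -> 0 <= dist g h,
      forall g h, G g -> G h -> dist g h = 0 <-> g = h,
      forall g h, G g -> G h -> dist g h = dist h g &
      forall g h k, G g -> G h -> G k -> dist g k <= dist g h + dist h k].

Definition left_invariant (dist : A -> A -> R) : Prop :=
  forall g h k, G g -> G h -> G k -> dist (g * h)%g (g * k)%g = dist h k.

Definition compatible (dist : A -> A -> R) : Prop :=
  forall g, G g -> forall P : set A,
    tau g P <-> exists2 e : R, 0 < e & forall h, G h -> dist g h < e -> P h.

Definition compatible_left_invariant_metric (dist : A -> A -> R) : Prop :=
  [/\ metric_on dist, left_invariant dist & compatible dist].

Definition maximal_metric (dist : A -> A -> R) : Prop :=
  compatible_left_invariant_metric dist /\
  forall dist', compatible_left_invariant_metric dist' ->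
    exists2 C : R, 0 < C &
      forall g h, G g -> G h -> dist' g h <= C * dist g h + C.

Definition quasi_isometry_for (dist : A -> A -> R) (f : A -> int) : Prop :=
  exists L C : R, [/\ 1 <= L, 0 <= C,
    forall g h, G g -> G h ->
      L^-1 * dist g h - C <= `|(f g)%:~R - (f h)%:~R| <= L * dist g h + C &
    forall n : int, exists2 g, G g & `|(f g)%:~R - n%:~R| <= C].

Definition quasi_isometry (f : A -> int) : Prop :=
  exists2 dist : A -> A -> R, maximal_metric dist & quasi_isometry_for dist f.

End Metrics.

(* Main.v *)
Require Import Defs.
From HB Require Import structures.
From mathcomp Require Import finmap generic_quotient.
From mathcomp Require Import all_boot all_order all_algebra.
From mathcomp Require Import all_classical all_reals all_analysis.
From mathcomp Require Import zify lra.

Set Implicit Arguments.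
Unset Strict Implicit.
Unset Printing Implicit Defensive.

Import Order.TTheory GRing.Theory Num.Theory.

Local Open Scope classical_set_scope.
Local Open Scope ring_scope.

(** Let [H x] be the forward half-orbit of [x] under [T]. For [S] in the
    commensurating full group, [Phi T S x] maps the natural numbers to the set
    of times at which the orbit of [x] visits the image of [H x] under [S]. Three
    facts reduce everything to these half-orbits.

    The metric. The stabilizers of half-lines already form a basis at the
    identity of the group of commensurating permutations, and the half-line
    starting at [m], seen from [x], is the half-line starting at [0], seen from
    [it m x]. Hence the group topology is given by the left-invariant metric
    [dcut S S'], the measure of the set of points [x] for which the images of
    [H x] under [S] and [S'] differ: passing from [x] to [it m x] is harmless
    because [T] is nonsingular. Two elements at [dcut]-distance less than [1]
    have the same index, so [com_dist], the sum of the variation of the index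
    and of [dcut], is a compatible left-invariant metric as well
    ([com_dist_compatible]). It differs by at most [1] from the variation of
    the index, and the powers of [T] take all integer values of the index, so
    that the index is a quasi-isometry for [com_dist].

    Maximality. Let [D] be a compatible left-invariant metric. Every element is
    the product of a power of [T] and an element of index zero, so it suffices
    to bound [D 1] on the kernel of the index ([kernel_bounded]). Take [e] such
    that [dcut 1 S < e] implies [D 1 S < 1].

    The kernel. Let [S] have index zero. One finite crossing pattern, the pair of
    the sets of integers leaving and entering the natural numbers, occurs on a
    set of positive measure; its two members have as many elements. Exchanging
    them in windows around a small subset [B] of this set gives an involution
    [p] with [dcut 1 p < e], such that [p * S] preserves [H b] for all [b] in [B]
    ([cut_after_swap]). Then [p * S] preserves the intervals between consecutive
    visits to [B], which are well defined since an ergodic map of an atomless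
    space is conservative ([backward_hit]). An interval lies in one orbit, so
    the space of intervals is atomless and can be cut into [N] pieces of measure
    less than [e], where [N] depends on [e] alone ([small_partition]). The
    restriction of [p * S] to one piece moves no half-orbit starting outside of
    this piece, hence is at [dcut]-distance less than [e] from the identity, and
    [p * S] is the product of these [N] restrictions ([cut_bounded]). So [D 1] is
    at most [N + 1] on the kernel. *)

(** * Index of commensurate sets of integers *)

Definition rel_index (A B : set int) : int :=
  #|` fset_set (A `\` B)|%:Z - #|` fset_set (B `\` A)|%:Z.

(** Inside a window the relative index is a difference of cardinalities; this
    is what makes it additive. *)
Lemma rel_index_window (W : {fset int}) (A B : set int) :
  A `+` B `<=` [set` W] ->
  rel_index A B = #|` [fset n in W | n \in A]%fset|%:Z - #|` [fset n in W | n \in B]%fset|%:Z.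
Proof.
move=> ABW; pose c (M : set int) := [fset n in W | n \in M]%fset.
have E (M N : set int) : M `+` N `<=` [set` W] -> fset_set (M `\` N) = (c M `\` c N)%fset.
  move=> MNW; rewrite -(set_fsetK (c M `\` c N)%fset); congr fset_set.
  apply/seteqP; split=> n /=.
    move=> [Mn Nn]; rewrite !inE /= (_ : n \in W); last by apply: MNW; left.
    by rewrite (mem_set Mn) (memNset Nn).
  by rewrite !inE /= => /andP[+ /andP[nW /set_mem Mn]]; rewrite nW /= => /negP nN; split=> // /mem_set.
rewrite /rel_index !E //; last by rewrite setYC.
have := cardfsID (c B) (c A); have := cardfsID (c A) (c B).
rewrite fsetIC /c; lia.
Qed.

Lemma rel_index_trans (A B C : set int) : finite_set (A `+` B) -> finite_set (B `+` C) ->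
  rel_index A C = rel_index A B + rel_index B C.
Proof.
move=> fAB fBC; pose W := fset_set ((A `+` B) `|` (B `+` C)).
have WE : [set` W] = (A `+` B) `|` (B `+` C) by rewrite fset_setK// finite_setU.
rewrite !(@rel_index_window W) ?WE; first by lia.
- by move=> n; right.
- by move=> n; left.
- move=> n [] [? ?]; case: (pselect (B n)) => ?.
  + by right; left.
  + by left; left.
  + by left; right.
  + by right; right.
Qed.

Lemma rel_index_image (s : int -> int) (A B : set int) : injective s ->
  finite_set (A `+` B) -> rel_index (s @` A) (s @` B) = rel_index A B.
Proof.
move=> si fAB.
have E (M N : set int) : finite_set (M `\` N) ->
    #|` fset_set (s @` M `\` s @` N)| = #|` fset_set (M `\` N)|.
  move=> fMN; rewrite (_ : s @` M `\` s @` N = s @` (M `\` N)).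
    by rewrite fset_set_image// card_imfset.
  apply/seteqP; split=> [_ [[n Mn <-] nN]|_ [n [Mn Nn] <-]].
    by exists n => //; split=> // Nn; apply: nN; exists n.
  by split; [exists n|move=> [m Nm /si mn]; apply: Nn; rewrite -mn].
by move: fAB; rewrite /setY finite_setU => -[? ?]; rewrite /rel_index !E.
Qed.

Lemma sym_index_comp (s t : int -> int) : is_symZN s -> is_symZN t ->
  sym_index (s \o t) = sym_index s + sym_index t.
Proof.
move=> [bs sN] [bt tN]; rewrite /sym_index -!/(rel_index _ _).
rewrite (@rel_index_trans _ (s @` natZ)).
- rewrite -[in X in _ + X = _]image_comp rel_index_image//; first exact: bij_inj.
  by rewrite setYC.
- by rewrite setYC.
- rewrite -image_comp -image_setY; last exact: bij_inj.
  by apply: finite_image; rewrite setYC.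
Qed.

Definition shift (n : int) : int := n + 1.

Lemma shift_natZ : shift @` natZ = natZ `\` [set 0].
Proof.
rewrite /natZ /shift; apply/seteqP; split=> [_ [n /= n0 <-]|n /= [n0 /eqP n1]].
  by split=> /=; [lia|apply/eqP; lia].
by exists (n - 1); [lia|rewrite subrK].
Qed.

Lemma is_symZN_shift : is_symZN shift.
Proof.
split; first by exists (fun n => n - 1) => n; rewrite /shift; lia.
apply: (@sub_finite_set _ _ [set 0]); last exact: finite_set1.
rewrite shift_natZ => n [[[]//]|[n0]] /=.
by case: (eqVneq n 0) => // /eqP n1 []; split.
Qed.

Lemma sym_index_shift : sym_index shift = 1.
Proof.
rewrite /sym_index shift_natZ setDD (_ : _ `\` _ `\` _ = set0); last first.
  by apply/seteqP; split=> // n [[]].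
rewrite fset_set0 cardfs0 subr0 (_ : _ `&` _ = [set 0]); last first.
  by apply/seteqP; split=> [n []//|n ->].
by rewrite fset_set1 cardfs1.
Qed.

(** * Nonsingular bijections and their orbits *)

Section AlmostEverywhere.
Context (R : realType) (d : measure_display) (X : measurableType d).
Variable mu : probability X R.

Lemma ae_forall_countable (I : countType) (P : I -> X -> Prop) :
  (forall i, {ae mu, forall x, P i x}) -> {ae mu, forall x, forall i, P i x}.
Proof.
move=> aP.
have: {ae mu, forall x, forall n, if unpickle n is Some i then P i x else True}.
  apply: ae_foralln => n; case: (unpickle n) => [i|]; first exact: aP.
  exact: aeW.
by apply: filterS => x Px i; have := Px (pickle i); rewrite pickleK.
Qed.

Lemma ae_and (P Q : X -> Prop) : {ae mu, forall x, P x} -> {ae mu, forall x, Q x} ->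
  {ae mu, forall x, P x /\ Q x}.
Proof. exact: filterS2. Qed.

Lemma ae_ex (P : X -> Prop) : {ae mu, forall x, P x} -> exists x, P x.
Proof.
move=> aP; apply: contrapT => nP.
suff : mu setT = 0%E by rewrite probability_setT => /eqP; rewrite onee_eq0.
apply/negligibleP => //; apply: negligibleS aP => x _ /= Px.
by apply: nP; exists x.
Qed.

Lemma ae_notP (A : set X) : measurable A ->
  mu A = 0%E <-> {ae mu, forall x, ~ A x}.
Proof.
move=> mA; split=> [/(negligibleP mu mA)|] A0.
  by apply: negligibleS A0 => x /= /contrapT.
by apply/(negligibleP mu mA); apply: negligibleS A0 => x Ax /=; apply.
Qed.

Lemma ae_le_measure (A B : set X) : measurable A -> measurable B ->
  {ae mu, forall x, A x -> B x} -> (mu A <= mu B)%E.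
Proof.
move=> mA mB AB; have mD : measurable (A `\` B) by exact: measurableD.
have D0 : mu (A `\` B) = 0%E.
  by apply/(ae_notP mD); apply: filterS AB => x /= AB [/AB].
rewrite -[leRHS]adde0 -D0; apply: le_trans (measureU2 _ mB mD).
apply: le_measure; rewrite ?inE//; first exact: measurableU.
by move=> x Ax; case: (pselect (B x)) => ?; [left|right].
Qed.

Lemma ae_eq_measure (A B : set X) : measurable A -> measurable B ->
  {ae mu, forall x, A x <-> B x} -> mu A = mu B.
Proof.
move=> mA mB AB; apply/eqP; rewrite eq_le.
by apply/andP; split; apply: ae_le_measure => //; apply: filterS AB => x [].
Qed.

Lemma pos_ae_ex (A : set X) (P : X -> Prop) : measurable A -> (0 < mu A)%E ->
  {ae mu, forall x, P x} -> exists2 x, A x & P x.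
Proof.
move=> mA A0 aP; apply: contrapT => nP.
have : mu A = 0%E.
  by apply/(ae_notP mA); apply: filterS aP => x Px Ax; apply: nP; exists x.
by move=> E; rewrite E ltxx in A0.
Qed.

Lemma pos_countable_cover (I : countType) (A : set X) (F : I -> set X) :
  measurable A -> (0 < mu A)%E -> (forall i, measurable (F i)) ->
  {ae mu, forall x, A x -> exists i, F i x} ->
  exists i, (0 < mu (A `&` F i))%E.
Proof.
move=> mA A0 mF AF; apply: contrapT => nF.
have : {ae mu, forall x, forall i, ~ (A `&` F i) x}.
  apply: ae_forall_countable => i; apply/ae_notP; first exact: measurableI.
  apply/eqP; rewrite eq_le measure_ge0 andbT leNgt; apply/negP => Fi.
  by apply: nF; exists i.
move=> nAF; have [x Ax [H K]] := pos_ae_ex mA A0 (ae_and AF nAF).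
by have [i Fi] := H Ax; exact: (K i).
Qed.

Lemma measure0_countable_cover (I : countType) (A : set X) (F : I -> set X) :
  measurable A -> (forall i, measurable (F i)) -> (forall i, mu (F i) = 0%E) ->
  {ae mu, forall x, A x -> exists i, F i x} -> mu A = 0%E.
Proof.
move=> mA mF F0 AF; apply/eqP; rewrite eq_le measure_ge0 andbT leNgt.
apply/negP => A0; have [i] := pos_countable_cover mA A0 mF AF.
rewrite ltNge => /negP; apply; rewrite -(F0 i).
by apply: le_measure; rewrite ?inE//; exact: measurableI.
Qed.

Lemma countable_bigcup_measurable (I : countType) (F : I -> set X) :
  (forall i, measurable (F i)) -> measurable [set x | exists i, F i x].
Proof.
move=> mF; pose G n := if unpickle n is Some i then F i else set0.
rewrite (_ : [set x | _] = \bigcup_n G n).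
  by apply: bigcupT_measurable => n; rewrite /G; case: unpickle.
apply/seteqP; split=> [x [i Fi]|x [n _]]; last first.
  by rewrite /G; case: unpickle => // i Fi; exists i.
by exists (pickle i) => //; rewrite /G pickleK.
Qed.

Lemma countable_bigcap_measurable (I : countType) (F : I -> set X) :
  (forall i, measurable (F i)) -> measurable [set x | forall i, F i x].
Proof.
move=> mF; rewrite (_ : [set x | _] = ~` [set x | exists i, (~` F i) x]).
  by apply/measurableC/countable_bigcup_measurable => i; exact: measurableC.
apply/seteqP; split=> [x Fx [i]|x nF i]; first exact.
by apply: contrapT => nFi; apply: nF; exists i.
Qed.

Lemma prop_measurable (P : Prop) : measurable [set _ : X | P].
Proof.
case: (pselect P) => HP.
  by rewrite (_ : [set _ | _] = setT)//; apply/seteqP; split.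
by rewrite (_ : [set _ | _] = set0)//; apply/seteqP; split.
Qed.

End AlmostEverywhere.

Section Iterates.
Context (R : realType) (d : measure_display) (X : measurableType d).
Variable mu : probability X R.
Implicit Type f : nsbij mu.

Lemma preim_measurable (g : X -> X) (A : set X) : measurable_fun setT g ->
  measurable A -> measurable (g @^-1` A).
Proof. by move=> mg mA; rewrite -[_ @^-1` _]setTI; exact: mg. Qed.

(** Nonsingularity in its quantitative form, uniform over all sets. *)
Lemma ns_abs_cont f (e : R) : 0 < e -> exists2 dl : R, 0 < dl &
  forall A, measurable A -> (mu A < dl%:E)%E -> (mu (f @^-1` A) < e%:E)%E.
Proof.
move=> e0; pose g : {mfun X >-> X} := mfun_Sub (mem_set (@ns_meas _ _ _ _ f)).
pose nu := charge_of_finite_measure (distribution mu g).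
have numu : nu `<< mu.
  by apply/null_content_dominatesP => A mA A0; apply/(ns_null f mA).
have [P [N nuPN]] := Hahn_decomposition nu.
have [dl [dl0 H]] := charge_variation_continuous nuPN numu e0.
exists dl => // A mA Adl; apply: le_lt_trans (H A mA Adl).
exact: le_trans (lee_abs _) (abse_charge_variation nuPN mA).
Qed.

Definition ns_it f (n : int) : X -> X :=
  match n with
  | Posz k => iter k f
  | Negz k => iter k.+1 (ns_inv f)
  end.

Lemma ns_it0 f x : ns_it f 0 x = x. Proof. by []. Qed.

Lemma ns_itS f n x : ns_it f (n + 1) x = f (ns_it f n x).
Proof.
case: n => [k|[|k]]; first by rewrite -PoszD addn1.
  by rewrite (_ : Negz 0 + 1 = 0)//= ns_invK.
rewrite (_ : Negz k.+1 + 1 = Negz k); last by rewrite !NegzE; lia.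
by rewrite [in RHS]/ns_it [in RHS]iterS ns_invK.
Qed.

Lemma ns_it1 f x : ns_it f 1 x = f x. Proof. by []. Qed.

Lemma ns_itD f m n x : ns_it f (m + n) x = ns_it f m (ns_it f n x).
Proof.
elim/int_rect: m => [|m IH|m IH]; first by rewrite add0r.
  by rewrite -addn1 PoszD addrAC !ns_itS IH.
apply: (can_inj (@ns_funK _ _ _ _ f)); rewrite -!ns_itS.
have E : - m.+1%:Z + 1 = - m%:Z by lia.
by rewrite addrAC E.
Qed.

Lemma ns_itK f n x : ns_it f (- n) (ns_it f n x) = x.
Proof. by rewrite -ns_itD addNr. Qed.

Lemma ns_itVK f n x : ns_it f n (ns_it f (- n) x) = x.
Proof. by rewrite -ns_itD addrN. Qed.

Lemma ns_it_bij f n : exists g : nsbij mu, forall x, g x = ns_it f n x.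
Proof.
suff H (g : nsbij mu) k : exists h : nsbij mu, forall x, h x = iter k g x.
  by case: n => k; [exact: H|exact: (H (ns_sym f) k.+1)].
elim: k => [|k [h hE]]; first by exists (ns_id mu).
by exists (ns_comp g h) => x /=; rewrite hE.
Qed.

Lemma ns_it_measurable f n : measurable_fun setT (ns_it f n).
Proof.
have [g gE] := ns_it_bij f n.
by rewrite (_ : ns_it f n = g); [exact: ns_meas|apply/funext => x].
Qed.

Lemma ns_it_preim_measurable f n (A : set X) :
  measurable A -> measurable (ns_it f n @^-1` A).
Proof. exact/preim_measurable/ns_it_measurable. Qed.

Lemma ns_it_null f n (A : set X) : measurable A ->
  mu (ns_it f n @^-1` A) = 0%E <-> mu A = 0%E.
Proof.
have [g gE] := ns_it_bij f n.
by rewrite (_ : ns_it f n = g); [exact: ns_null|apply/funext => x].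
Qed.

Lemma ae_orbit f (P : X -> Prop) : {ae mu, forall x, P x} ->
  {ae mu, forall x, forall n, P (ns_it f n x)}.
Proof.
move=> aP; apply: ae_forall_countable => n; have [g gE] := ns_it_bij f n.
by apply: filterS (ns_ae g aP) => x; rewrite gE.
Qed.

End Iterates.

(** * Cutting a standard atomless space into small pieces *)

Section SmallPieces.
Context (R : realType) (d : measure_display) (X : measurableType d).
Variable mu : probability X R.

Lemma iff_measurable (A B : set X) : measurable A -> measurable B ->
  measurable [set x | A x <-> B x].
Proof.
move=> mA mB; rewrite (_ : [set x | _] = (A `&` B) `|` (~` A `&` ~` B)).
  by apply: measurableU; apply: measurableI => //; exact: measurableC.
apply/seteqP; split=> [x AB|x [[Ax Bx]|[Ax Bx]]]; last 2 first.
- by split.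
- by split=> [/Ax|/Bx].
by have [Ax|Ax] := pselect (A x); [left|right]; split=> //; [exact/AB|move=> /AB].
Qed.

Definition separating (E : nat -> set X) : Prop :=
  (forall i, measurable (E i)) /\
  (forall x y, (forall i, E i x <-> E i y) -> x = y).

Lemma standard_separating : standard_borel R X -> exists E, separating E.
Proof.
move=> [Y [f [hY [B cB [Bo Bb]] bf mX]]].
have sep (x y : Y) : x <> y -> exists U, [/\ B U, U x & ~ U y].
  move: hY; rewrite open_hausdorff => hY /eqP /hY [[U V] /= [/set_mem Ux /set_mem Vy]].
  move=> [oU oV /eqP UV]; have [W [BW Wx] WU] := Bb x _ (open_nbhs_nbhs (conj oU Ux)).
  exists W; split=> // Wy; suff : (U `&` V) y by rewrite UV.
  by split=> //; exact: WU.
move: cB => /pfcard_geP[B0|[g]].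
  exists (fun=> set0); split=> // x y _; apply: contrapT => xy.
  have [|U []] := sep (f x) (f y); last by rewrite B0.
  by move=> /(bij_inj bf).
have gB i : B (g i) by exact: funS.
exists (fun i => f @^-1` (g i)); split=> [i|x y H].
  by apply/mX; exists (g i) => //; apply: sub_sigma_algebra; exact: Bo.
apply: contrapT => xy.
have [|U [BU Ux Uy]] := sep (f x) (f y); first by move=> /(bij_inj bf).
have [i _ gi] := @surj _ _ _ _ g _ BU.
by apply: Uy; rewrite -gi; apply/(H i) => /=; rewrite gi.
Qed.

Lemma eq_fun_measurable (E : nat -> set X) (g h : X -> X) : separating E ->
  measurable_fun setT g -> measurable_fun setT h -> measurable [set x | g x = h x].
Proof.
move=> [mE sE] mg mh.
rewrite (_ : [set x | _] = [set x | forall i, E i (g x) <-> E i (h x)]).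
  apply: countable_bigcap_measurable => i.
  by apply: iff_measurable; exact: preim_measurable.
by apply/seteqP; split=> [x /= ->//|x /= /sE].
Qed.

Lemma point_null (E : nat -> set X) (x : X) : separating E -> atomless mu ->
  measurable [set x] /\ mu [set x] = 0%E.
Proof.
move=> sE hmu; have mx : measurable [set x].
  rewrite (_ : [set x] = [set y | y = cst x y]).
    by apply: (eq_fun_measurable sE) => //; exact: measurable_cst.
  by apply/seteqP; split=> y.
split=> //; apply/eqP; rewrite eq_le measure_ge0 andbT leNgt; apply/negP => x0.
have [B [mB Bx B0]] := hmu _ mx x0; rewrite ltNge => /negP; apply.
apply: le_measure; rewrite ?inE// => _ ->; apply: contrapT => nBx.
suff B_0 : B = set0 by rewrite B_0 measure0 ltxx in B0.
by apply/seteqP; split=> // y By; apply: nBx; rewrite -(Bx _ By).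
Qed.

Lemma decreasing_measure_ge (F : nat -> set X) (e : R) :
  (forall k, measurable (F k)) -> (forall k, F k.+1 `<=` F k) ->
  (forall k, (e%:E <= mu (F k))%E) -> (e%:E <= mu (\bigcap_k F k))%E.
Proof.
move=> mF FS eF; have ni : nonincreasing_seq F.
  by apply/nonincreasing_seqP => n; apply/subsetPset.
have F0 : (mu (F 0%N) < +oo)%E by rewrite -ge0_fin_numE// fin_num_measure.
have cF := nonincreasing_cvg_mu F0 mF (bigcapT_measurable mF) ni.
rewrite -(cvg_lim _ cF)//; apply: lime_ge; last exact: nearW.
by apply/cvg_ex; exists (mu (\bigcap_k F k)).
Qed.

Definition code (E : nat -> set X) (k : nat) (x : X) : {ffun 'I_k -> bool} :=
  [ffun i : 'I_k => `[< E i x >]].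

Lemma codeP (E : nat -> set X) k x y :
  code E k x = code E k y <-> forall i, (i < k)%N -> (E i x <-> E i y).
Proof.
split=> [/ffunP xy i ik|xy].
  have := xy (Ordinal ik); rewrite !ffunE /= => xyi.
  by split=> /asboolP; [rewrite xyi|rewrite -xyi] => /asboolP.
by apply/ffunP => i; rewrite !ffunE; apply: asbool_equiv_eq; exact: xy.
Qed.

Lemma code_measurable (E : nat -> set X) k w : (forall i, measurable (E i)) ->
  measurable [set x | code E k x = w].
Proof.
move=> mE; rewrite (_ : [set x | _] = [set x | forall i : 'I_k, E i x <-> w i]).
  by apply: countable_bigcap_measurable => i; apply: iff_measurable => //; exact: prop_measurable.
apply/seteqP; split=> [x /= <- i|x /= H].
  by rewrite ffunE; split=> /asboolP.
by apply/ffunP => i; rewrite ffunE; apply/idP/idP => [/asboolP/H|/H/asboolP].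
Qed.

(** Were there atoms of measure more than [e] at every level, the unions of
    these atoms would decrease to a set of measure at least [e]; a point of it
    lies in a decreasing sequence of atoms of measure more than [e], whose
    intersection is not null. *)
Lemma small_code (E : nat -> set X) (e : R) : 0 < e ->
  (forall i, measurable (E i)) ->
  (forall x, mu [set y | forall i, E i y <-> E i x] = 0%E) ->
  exists k, forall w, (mu [set x | code E k x = w] <= e%:E)%E.
Proof.
move=> e0 mE E0; apply: contrapT => nk.
pose A k x := [set y | code E k y = code E k x].
have mA k x : measurable (A k x) by exact: code_measurable.
pose Z k := [set x | (e%:E < mu (A k x))%E].
have mZ k : measurable (Z k).
  rewrite (_ : Z k = [set x | exists w, [set x | code E k x = w /\
      (e%:E < mu [set y | code E k y = w])%E] x]).
    apply: countable_bigcup_measurable => w.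
    by apply: measurableI; [exact: code_measurable|exact: prop_measurable].
  apply/seteqP; split=> [x Zx|x [w [<-]]//].
  by exists (code E k x).
have AS k x : A k.+1 x `<=` A k x.
  by move=> y /codeP H; apply/codeP => i ik; apply: H; exact: ltnW.
have ZS k : Z k.+1 `<=` Z k.
  move=> x /= /lt_le_trans; apply; apply: le_measure; rewrite ?inE//.
have eZ k : (e%:E <= mu (Z k))%E.
  apply: contrapT => /negP; rewrite -ltNge => Ze; apply: nk; exists k => w.
  rewrite leNgt; apply/negP => ew.
  have : (mu [set x | code E k x = w] <= mu (Z k))%E.
    apply: le_measure; rewrite ?inE//; first exact: code_measurable.
    by move=> x xw; rewrite /Z /A /= xw.
  by move=> /le_lt_trans/(_ Ze)/(lt_trans ew); rewrite ltxx.
have := decreasing_measure_ge mZ ZS eZ.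
have [->|/set0P[x Zx] _] := eqVneq (\bigcap_k Z k) set0.
  by rewrite measure0 lee_fin leNgt e0.
have : (e%:E <= mu (\bigcap_k A k x))%E.
  by apply: decreasing_measure_ge => // k; exact/ltW/Zx.
rewrite (_ : \bigcap_k A k x = [set y | forall i, E i y <-> E i x]).
  by rewrite E0 lee_fin leNgt e0.
apply/seteqP; split=> [y Hy i|y Hy k _].
  by have /codeP/(_ i (ltnSn i)) := Hy i.+1 I.
exact/codeP.
Qed.

(** The fibres are ranked, and grouped according to the integer part of their
    cumulative measure divided by [e]: inside a group the cumulative measure
    varies by less than [e], to which the first fibre adds at most [e]. *)
Lemma group_fibres (W : finType) (c : X -> W) (e : R) : 0 < e ->
  (forall w, measurable [set x | c x = w]) ->
  (forall w, (mu [set x | c x = w] <= e%:E)%E) ->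
  exists2 g : W -> nat, forall w, (g w < (Num.trunc e^-1).+1)%N &
    forall q, (mu [set x | g (c x) = q] <= (e + e)%:E)%E.
Proof.
move=> e0 mc ce.
have mP (P : W -> Prop) : measurable [set x | P (c x)].
  rewrite (_ : [set x | _] = [set x | exists w, [set x | c x = w /\ P w] x]).
    apply: countable_bigcup_measurable => w.
    by apply: measurableI; [exact: mc|exact: prop_measurable].
  by apply/seteqP; split=> [x Px|x [w [<-]]//]; exists (c x).
pose L (w : W) := [set x : X | (enum_rank (c x) <= enum_rank w)%N].
have mL w : measurable (L w) by exact: (mP (fun v => (enum_rank v <= enum_rank w)%N : Prop)).
pose F (w : W) := fine (mu (L w)).
have FE w : mu (L w) = (F w)%:E by rewrite fineK// fin_num_measure.
have F0 w : 0 <= F w by exact/fine_ge0/measure_ge0.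
exists (fun w => Num.trunc (F w / e)) => [w|q].
  rewrite ltnS; apply: le_truncn; rewrite -[leRHS]mul1r ler_wpM2r ?invr_ge0 ?(ltW e0)//.
  by rewrite -lee_fin -FE probability_le1.
pose P (w : W) := Num.trunc (F w / e) == q.
have [w0 Pw0|nP] := pickP P; last first.
  rewrite (_ : [set x | _] = set0) ?measure0 ?lee_fin ?addr_ge0 ?(ltW e0)//.
  by apply/seteqP; split=> // x /= /eqP; have := nP (c x); rewrite /P => ->.
have PF w : P w -> q%:R * e <= F w < q.+1%:R * e.
  move=> /eqP <-; have := truncn_itv (divr_ge0 (F0 w) (ltW e0)).
  by rewrite ler_pdivlMr// ltr_pdivrMr.
pose a := [arg min_(w < w0 | P w) (enum_rank w : nat)].
pose b := [arg max_(w > w0 | P w) (enum_rank w : nat)].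
have [Pa amin] : P a /\ forall w, P w -> (enum_rank a <= enum_rank w)%N.
  by rewrite /a; case: arg_minnP => // i Pi H; split.
have [Pb bmax] : P b /\ forall w, P w -> (enum_rank w <= enum_rank b)%N.
  by rewrite /b; case: arg_maxnP => // i Pi H; split.
have Lab : L a `<=` L b by move=> x /= /leq_trans; apply; exact: bmax.
apply: (@le_trans _ _ (mu ([set x | c x = a] `|` (L b `\` L a)))).
  apply: le_measure; rewrite ?inE//.
  - exact: (mP (fun v => Num.trunc (F v / e) = q)).
  - by apply: measurableU => //; exact: measurableD.
  move=> x /= /eqP Px; have [->|xa] := eqVneq (c x) a; [by left|right].
  split; first exact: bmax.
  move=> /= xa'; move/eqP: xa; apply; apply: enum_rank_inj; apply/val_inj => /=.
  by apply/eqP; rewrite eqn_leq xa'/=; exact: amin.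
apply: (le_trans (measureU2 _ _ _)) => //; first exact: measurableD.
rewrite EFinD; apply: leeD; first exact: ce.
rewrite measureD//; last by rewrite -ge0_fin_numE// fin_num_measure.
rewrite (_ : L b `&` L a = L a); last by apply/setIidPr.
have /andP[_] := PF _ Pb; have /andP[+ _] := PF _ Pa.
move=> Fa Fb; apply: (@le_trans _ _ ((F b)%:E - (F a)%:E)%E); first by rewrite -!FE.
rewrite -EFinB lee_fin; move: Fb; rewrite mulrSr mulrDl mul1r; lra.
Qed.

(** The pieces are unions of atoms of [E], so they are saturated under any
    equivalence relation preserving each [E i]. They are obtained by grouping
    the small atoms of a finite level, and for this reason their number is
    bounded in terms of [e] alone. *)
Lemma small_partition (e : R) : 0 < e -> exists N : nat,
  forall E : nat -> set X, (forall i, measurable (E i)) ->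
  (forall x, mu [set y | forall i, E i y <-> E i x] = 0%E) ->
  exists g : X -> nat, [/\ forall x, (g x < N)%N,
    forall q, measurable [set x | g x = q],
    forall q, (mu [set x | g x = q] < e%:E)%E &
    forall x y, (forall i, E i x <-> E i y) -> g x = g y].
Proof.
move=> e0; have e3 : 0 < e / 3 by rewrite divr_gt0.
exists (Num.trunc (e / 3)^-1).+1 => E mE E0.
have [k ke] := small_code e3 mE E0.
have mc (w : {ffun 'I_k -> bool}) := code_measurable w mE.
have [g gN ge] := group_fibres e3 mc ke.
exists (fun x => g (code E k x)); split=> [//|q|q|x y xy].
- rewrite (_ : [set x | _] = [set x | exists w, [set x | code E k x = w /\ g w = q] x]).
    apply: countable_bigcup_measurable => w.
    by apply: measurableI; [exact: mc|exact: prop_measurable].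
  by apply/seteqP; split=> [x Px|x [w [<-]]//]; exists (code E k x).
- by apply: le_lt_trans (ge q) _; rewrite lte_fin; lra.
- by congr g; apply/codeP => i _; exact: xy.
Qed.

Lemma small_subset (E : nat -> set X) (A : set X) (e : R) : separating E ->
  atomless mu -> measurable A -> (0 < mu A)%E -> 0 < e ->
  exists B, [/\ measurable B, B `<=` A, (0 < mu B)%E & (mu B < e%:E)%E].
Proof.
move=> sE hmu mA A0 e0; have [N /(_ E sE.1)[]] := small_partition e0.
  move=> x; rewrite (_ : [set y | _] = [set x]); first by have [] := point_null x sE hmu.
  by apply/seteqP; split=> [y /sE.2//|_ -> i].
move=> g [_ mg ge _].
have [|q Aq] := pos_countable_cover mA A0 mg; first by apply: aeW => x _; exists (g x).
exists (A `&` [set x | g x = q]); split=> //; first exact: measurableI.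
by apply: le_lt_trans (ge q); apply: le_measure; rewrite ?inE//; exact: measurableI.
Qed.

End SmallPieces.

(** * Ergodic dynamics *)

Section Dynamics.
Context (R : realType) (d : measure_display) (X : measurableType d).
Variable mu : probability X R.
Implicit Type f : nsbij mu.

Lemma abs_cont_window f (s : seq int) (e : R) : 0 < e -> exists2 dl : R, 0 < dl &
  forall A, measurable A -> (mu A < dl%:E)%E ->
    (mu [set x | exists n, n \in s /\ A (ns_it f n x)] < e%:E)%E.
Proof.
elim: s e => [|n s IH] e e0.
  exists 1 => // A mA _; rewrite (_ : [set x | _] = set0).
    by rewrite measure0 lte_fin.
  by apply/seteqP; split=> // x [n []].
have [dl1 dl10 H1] := IH _ (divr_gt0 e0 (@ltr0n _ 2)).
have [g gE] := ns_it_bij f n.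
have [dl2 dl20 H2] := ns_abs_cont g (divr_gt0 e0 (@ltr0n R 2)).
exists (Num.min dl1 dl2) => [|A mA Adl]; first by rewrite lt_min dl10.
have {}H1 := H1 A mA (lt_le_trans Adl _); have {}H2 := H2 A mA (lt_le_trans Adl _).
rewrite (_ : [set x | _] = g @^-1` A `|` [set x | exists n, n \in s /\ A (ns_it f n x)]).
  rewrite (splitr e) EFinD; apply: le_lt_trans (measureU2 _ _ _) _.
  - exact: ns_preimage_measurable.
  - apply: countable_bigcup_measurable => m; apply: measurableI.
      exact: prop_measurable.
    exact: ns_it_preim_measurable.
  - by apply: lteD; [apply: H2|apply: H1]; rewrite lee_fin ge_min lexx ?orbT.
apply/seteqP; split=> [x [m []]|x /= [|[m [ms Am]]]].
- rewrite inE => /orP[/eqP-> Am|ms Am]; first by left; rewrite /= gE.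
  by right; exists m.
- by exists n; rewrite inE eqxx -gE.
- by exists m; rewrite inE ms orbT.
Qed.

Definition ergodic_map f : Prop :=
  forall A : set X, measurable A -> f @^-1` A = A -> mu A = 0%E \/ mu (~` A) = 0%E.

Lemma orbit_union_measurable f (A : set X) : measurable A ->
  measurable [set x | exists n, A (ns_it f n x)].
Proof.
by move=> mA; apply: countable_bigcup_measurable => n; exact: ns_it_preim_measurable.
Qed.

Lemma ergodic_hit f (A : set X) : ergodic_map f -> measurable A -> (0 < mu A)%E ->
  {ae mu, forall x, exists n, A (ns_it f n x)}.
Proof.
move=> ef mA A0; have mS := orbit_union_measurable f mA.
have [|S0|] := ef _ mS.
- apply/seteqP; split=> [x /= [n]|x /= [n]].
    by rewrite -ns_it1 -ns_itD => ?; exists (n + 1).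
  move=> An; exists (n - 1); rewrite -(ns_it1 f x) -ns_itD subrK//.
- have : (mu A <= mu [set x | exists n, A (ns_it f n x)])%E.
    by apply: le_measure; rewrite ?inE// => x Ax; exists 0.
  by rewrite S0 leNgt A0.
- move=> /ae_notP H; apply: filterS (H _) => [x /contrapT//|].
  exact: measurableC.
Qed.

(** An ergodic map of an atomless space is conservative: were the set of first
    visits to [A] not null, it could be cut into two non-null pieces, and almost
    every orbit would meet both, hence have two first visits. *)
Lemma backward_hit f (A : set X) : atomless mu -> ergodic_map f ->
  measurable A -> (0 < mu A)%E ->
  {ae mu, forall x, exists k : nat, A (ns_it f (- k%:Z) x)}.
Proof.
move=> hmu ef mA A0.
pose L := [set x | A x /\ forall k : nat, ~ A (ns_it f (- k.+1%:Z) x)].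
have mL : measurable L.
  apply: measurableI => //; apply: countable_bigcap_measurable => k.
  exact/measurableC/ns_it_preim_measurable.
have L1 x m n : L (ns_it f m x) -> L (ns_it f n x) -> m <= n.
  move=> [_ Hm] [An _]; rewrite leNgt; apply/negP => nm.
  pose q := (m - n - 1)%R; have := Hm (absz q); rewrite -ns_itD; apply.
  by rewrite (_ : _ + m = n)// /q; lia.
have L0 : mu L = 0%E.
  apply/eqP; rewrite eq_le measure_ge0 andbT leNgt; apply/negP => L0.
  have [B [mB BL B0 BLlt]] := hmu _ mL L0.
  have mLB : measurable (L `\` B) by exact: measurableD.
  have LB0 : (0 < mu (L `\` B))%E.
    rewrite measureD//; last by rewrite -ge0_fin_numE// fin_num_measure.
    by rewrite (_ : L `&` B = B) ?sube_gt0//; exact/setIidPr.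
  have [x [[m Bm] [n [Ln nBn]]]] :=
    ae_ex (ae_and (ergodic_hit ef mB B0) (ergodic_hit ef mLB LB0)).
  have mn : m = n by apply/le_anti/andP; split; apply: (@L1 x) => //; exact: BL.
  by apply: nBn; rewrite -mn.
have nL : {ae mu, forall x, forall n, ~ L (ns_it f n x)}.
  by apply: (@ae_orbit _ _ _ _ f (fun x => ~ L x)); apply/ae_notP.
apply: filterS2 nL (ergodic_hit ef mA A0) => x nL [n An].
apply: contrapT => nk.
have Ap0 : exists p : nat, `[< A (ns_it f p x) >].
  case: n An => p An; first by exists p; apply/asboolP.
  by exfalso; apply: nk; exists p.+1; rewrite -NegzE.
have [p /asboolP Ap pmin] := ex_minnP Ap0.
apply: (nL p); split=> // k; rewrite -ns_itD => Ak.
have [pk|kp] := leqP p k.+1.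
  apply: nk; exists (k.+1 - p)%N.
  by rewrite (_ : - _ = - k.+1%:Z + p%:Z)//; lia.
have := pmin (p - k.+1)%N; rewrite (_ : (p - k.+1)%N%:Z = - k.+1%:Z + p%:Z); last by lia.
by move=> /(_ (asboolT Ak)); lia.
Qed.

(** If a power [k.+1] fixed all points of a non-null set, the orbits of the
    points of a small subset would be covered by [k.+1] translates of this
    subset, of total measure less than [1], although they fill the space. *)
Lemma ergodic_free f (E : nat -> set X) : separating E -> atomless mu ->
  ergodic_map f -> {ae mu, forall x, forall n, n != 0 -> ns_it f n x <> x}.
Proof.
move=> sE hmu ef; suff H (k : nat) : {ae mu, forall x, ns_it f k.+1%:Z x <> x}.
  apply: filterS (ae_foralln H) => x Hx [[//|k] _|k _]; first exact: Hx.
  by rewrite NegzE => /(congr1 (ns_it f k.+1)); rewrite ns_itVK => /esym; exact: Hx.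
pose P := [set x | ns_it f k.+1%:Z x = x].
have mP : measurable P.
  by apply: (eq_fun_measurable sE) => //; exact: ns_it_measurable.
apply/(ae_notP mu mP); apply/eqP; rewrite eq_le measure_ge0 andbT leNgt; apply/negP => P0.
pose s := [seq i%:Z | i <- iota 0 k.+1].
have [dl dl0 H] := abs_cont_window f s (@ltr01 R).
have [B [mB BP B0 Bdl]] := small_subset sE hmu mP P0 dl0.
have := H B mB Bdl; rewrite ltNge => /negP; apply.
rewrite -(probability_setT mu); apply: ae_le_measure => //.
  apply: countable_bigcup_measurable => m; apply: measurableI.
    exact: prop_measurable.
  exact: ns_it_preim_measurable.
apply: filterS (ergodic_hit ef mB B0) => x [m Bm] _.
have per q y : P y -> ns_it f (q * k.+1%:Z) y = y.
  move=> Py; elim/int_rect: q => [|q IH|q IH]; first by rewrite mul0r.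
    by rewrite -addn1 PoszD mulrDl mul1r ns_itD Py.
  rewrite (_ : - q.+1%:Z * _ = - k.+1%:Z + (- q%:Z * k.+1%:Z)); last by lia.
  by rewrite ns_itD IH -{1}Py ns_itK.
exists (m %% k.+1)%Z; split.
  apply/mapP; exists `|(m %% k.+1)%Z|%N; last by rewrite gez0_abs// modz_ge0.
  rewrite mem_iota add0n leq0n /=; have := ltz_pmod m (ltn0Sn k : 0 < k.+1%:Z).
  have := @modz_ge0 m k.+1 isT; lia.
have Px : P (ns_it f m x) by exact: BP.
rewrite (_ : (m %% _)%Z = - (m %/ k.+1)%Z * k.+1%:Z + m); last first.
  by rewrite {3}(divz_eq m k.+1) mulNr addKr.
by rewrite ns_itD per.
Qed.

(** Rokhlin towers. Almost every point [x] is separated from [it n x] by some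
    [E i], so countably many sets disjoint from their translate by [n] cover the
    given set, and one of them is kept for each [n] in turn. *)
Lemma tower_base f (E : nat -> set X) (A : set X) (s : seq int) (e : R) :
  separating E -> atomless mu -> ergodic_map f -> measurable A -> (0 < mu A)%E ->
  0 < e -> exists B, [/\ measurable B, B `<=` A, (0 < mu B)%E,
    (mu [set x | exists n, n \in s /\ B (ns_it f n x)] < e%:E)%E &
    forall x n, n \in s -> n != 0 -> B x -> ~ B (ns_it f n x)].
Proof.
move=> sE hmu ef mA A0 e0.
have [dl dl0 H] := abs_cont_window f s e0.
have [B [mB BA B0 Bdl]] := small_subset sE hmu mA A0 dl0.
suff [C [mC CB C0 CH]] : exists C, [/\ measurable C, C `<=` B, (0 < mu C)%E &
    forall x n, n \in s -> n != 0 -> C x -> ~ C (ns_it f n x)].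
  exists C; split=> //; first exact: subset_trans BA.
  by apply: H => //; apply: le_lt_trans Bdl; apply: le_measure; rewrite ?inE.
elim: s {H} => [|n s [C [mC CB C0 CH]]]; first by exists B; split.
have [->|n0] := eqVneq n 0.
  exists C; split=> // x m; rewrite inE => /orP[/eqP-> /eqP//|]; exact: CH.
pose F (ib : nat * bool) := if ib.2
  then [set x | E ib.1 x /\ ~ E ib.1 (ns_it f n x)]
  else [set x | ~ E ib.1 x /\ E ib.1 (ns_it f n x)].
have mF ib : measurable (F ib).
  have mE1 := sE.1 ib.1; have mE2 := ns_it_preim_measurable f n mE1.
  by rewrite /F; case: ib.2; apply: measurableI => //; exact: measurableC.
have [|ib Ci] := pos_countable_cover mC C0 mF.
  apply: filterS (ergodic_free sE hmu ef) => x /(_ n n0) nx _.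
  apply: contrapT => nF; apply: nx; apply: sE.2 => i; split=> [Ei|Ei].
    by apply: contrapT => nEi; apply: nF; exists (i, false).
  by apply: contrapT => nEi; apply: nF; exists (i, true).
exists (C `&` F ib); split=> //; first exact: measurableI.
- by move=> x [/CB].
- move=> x m; rewrite inE => /orP[/eqP-> _|ms m0] [Cx Fx] [Cm Fm].
    by move: Fx Fm; rewrite /F; case: ib.2 => -[? ?] [? ?].
  exact: CH ms m0 Cx Cm.
Qed.

End Dynamics.

(** * The action of the full group on orbits *)

Section Orbits.
Context (R : realType) (d : measure_display) (X : measurableType d).
Variable mu : probability X R.
Variable t : nsbij mu.
Implicit Types f g : nsbij mu.

Local Notation it := (ns_it t).

Definition free (x : X) : Prop := forall n, n != 0 -> it n x <> x.

Lemma free_inj x : free x -> injective (it^~ x).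
Proof.
move=> fx m n /= mn; apply: contrapT => /eqP; rewrite -subr_eq0 => /fx; apply.
by rewrite addrC ns_itD mn ns_itK.
Qed.

Lemma free_orbit x m : free x -> free (it m x).
Proof.
move=> fx n n0; rewrite -ns_itD => /free_inj => /(_ fx) /eqP.
by rewrite -subr_eq0 addrK (negbTE n0).
Qed.

(** The orbit of [x] is free and invariant under [f], hence [f] acts on it as a
    permutation of the integers. Invariance under the inverse is what makes
    [phi f x] surjective. *)
Definition good f (x : X) : Prop :=
  [/\ free x, forall n, exists m, f (it n x) = it m x &
      forall n, exists m, ns_inv f (it n x) = it m x].

(** The cocycle action for a representative: [Phi_fun T S] is
    [phi (repr T) (repr S)]. *)
Definition phi f (x : X) (n : int) : int :=
  n + xget 0 [set k | f (it n x) = it k (it n x)].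

Lemma phiE f x n : good f x -> it (phi f x n) x = f (it n x).
Proof.
move=> [_ /(_ n)[m fm] _]; rewrite /phi addrC ns_itD; apply/esym.
apply: (@xgetPex _ _ [set k | f (it n x) = it k (it n x)]).
by exists (m - n); rewrite /= -ns_itD subrK.
Qed.

Lemma phi_eq f x n m : good f x -> f (it n x) = it m x -> phi f x n = m.
Proof. by move=> gf; rewrite -phiE// => /free_inj; apply; case: gf. Qed.

Lemma good_sym f x : good f x -> good (ns_sym f) x.
Proof. by case. Qed.

Lemma good_comp f g x : good f x -> good g x -> good (ns_comp f g) x.
Proof.
move=> [fx f1 f2] [_ g1 g2]; split=> // n /=.
  by have [m ->] := g1 n; exact: f1.
by have [m ->] := f2 n; exact: g2.
Qed.

Lemma good_orbit f x m : good f x -> good f (it m x).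
Proof.
move=> [fx f1 f2]; split; first exact: free_orbit.
  by move=> n; rewrite -ns_itD; have [k ->] := f1 (n + m); exists (k - m); rewrite -ns_itD subrK.
by move=> n; rewrite -ns_itD; have [k ->] := f2 (n + m); exists (k - m); rewrite -ns_itD subrK.
Qed.

Lemma good_id x : free x -> good (ns_id mu) x.
Proof. by split=> // n; exists n. Qed.

Lemma good_t x : free x -> good t x.
Proof.
split=> // n; first by exists (n + 1); rewrite ns_itS.
by exists (n - 1); rewrite -{1}(subrK 1 n) ns_itS ns_funK.
Qed.

Lemma phi_id x n : free x -> phi (ns_id mu) x n = n.
Proof. by move=> fx; apply: phi_eq => //; exact: good_id. Qed.

Lemma phi_t x : free x -> phi t x = shift.
Proof.
move=> fx; apply/funext => n; apply: phi_eq; first exact: good_t.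
by rewrite ns_itS.
Qed.

Lemma phi_comp f g x : good f x -> good g x ->
  phi (ns_comp f g) x = phi f x \o phi g x.
Proof.
move=> gf gg; apply/funext => n; apply: phi_eq; first exact: good_comp.
by rewrite /= !phiE.
Qed.

Lemma phi_symK f x : good f x -> cancel (phi f x) (phi (ns_sym f) x).
Proof.
move=> gf n; apply: phi_eq; first exact: good_sym.
by rewrite phiE//= ns_funK.
Qed.

Lemma phi_Ksym f x : good f x -> cancel (phi (ns_sym f) x) (phi f x).
Proof.
move=> gf n; apply: phi_eq => //; rewrite phiE//=; last exact: good_sym.
by rewrite ns_invK.
Qed.

Lemma phi_bij f x : good f x -> bijective (phi f x).
Proof. by move=> gf; exists (phi (ns_sym f) x); [exact: phi_symK|exact: phi_Ksym]. Qed.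

Lemma phi_orbit f x m n : good f x -> phi f (it m x) n = phi f x (n + m) - m.
Proof.
move=> gf; apply: phi_eq; first exact: good_orbit.
by rewrite -!ns_itD subrK phiE.
Qed.

Lemma phi_ext f g x : (forall n, f (it n x) = g (it n x)) -> phi f x = phi g x.
Proof. by move=> fg; apply/funext => n; rewrite /phi fg. Qed.

Lemma symZN_sym f x : good f x -> is_symZN (phi f x) -> is_symZN (phi (ns_sym f) x).
Proof.
move=> gf sf; rewrite (_ : phi (ns_sym f) x = fun_inv (phi f x)); first exact: is_symZN_inv.
by apply/funext => n; rewrite -[n in RHS](phi_Ksym gf) fun_invK//; exact: phi_bij.
Qed.

Lemma ae_ext f g : {ae mu, forall x, f x = g x} ->
  {ae mu, forall x, forall n, f (it n x) = g (it n x)}.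
Proof. exact: ae_orbit. Qed.

(** Representatives of the elements of [com_full_group]. *)
Definition nscom f : Prop :=
  {ae mu, forall x, exists n, f x = it n x} /\ {ae mu, forall x, is_symZN (phi f x)}.

Lemma nscom_ext f g : {ae mu, forall x, f x = g x} -> nscom f -> nscom g.
Proof.
move=> fg [f1 f2]; split; first by apply: filterS2 fg f1 => x -> .
by apply: filterS2 (ae_ext fg) f2 => x /phi_ext ->.
Qed.

(** The forward half-orbit: it replaces [natZ] when sets of integers depending
    on [x] are described by sets of points, for which measurability is plain. *)
Definition half (x : X) : set X := [set y | exists2 n, 0 <= n & it n x = y].

Lemma half_phi f x n : good f x ->
  (f @` half x) (it n x) <-> (phi f x @` natZ) n.
Proof.
move=> gf; split=> [[_ [m m0 <-] fm]|[m m0 <-]].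
  by exists m => //; exact: phi_eq.
by exists (it m x); [exists m|rewrite phiE].
Qed.

Lemma half_phi_eq f g x : good f x -> good g x ->
  f @` half x = g @` half x <-> phi f x @` natZ = phi g x @` natZ.
Proof.
move=> gf gg; split=> [E|E].
  by apply/seteqP; split=> n; rewrite -!half_phi// E.
have H (h k : nsbij mu) : good h x -> good k x -> phi h x @` natZ = phi k x @` natZ ->
    h @` half x `<=` k @` half x.
  move=> gh gk hk y hy; case: (hy) => _ [m m0 <-] hm; move: hy.
  by rewrite -hm -phiE// !half_phi// hk.
by apply/seteqP; split; apply: H.
Qed.

Lemma half_orbit x m n : free x -> half (it m x) (it n x) <-> m <= n.
Proof.
move=> fx; split=> [[k k0]|mn]; first by rewrite -ns_itD => /(free_inj fx) <-; lia.
by exists (n - m); [lia|rewrite -ns_itD subrK].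
Qed.

End Orbits.

Section FullGroup.
Context (R : realType) (d : measure_display) (X : measurableType d).
Variables (mu : probability X R) (t : nsbij mu).
Context (ft : {ae mu, forall x, free t x}).
Implicit Types f g : nsbij mu.
Local Notation it := (ns_it t).
Local Notation phi := (phi t).
Local Notation good := (good t).
Local Notation nscom := (nscom t).

Lemma ae_full_good f : {ae mu, forall x, exists n, f x = it n x} ->
  {ae mu, forall x, good f x}.
Proof.
move=> f1.
have f2 : {ae mu, forall x, exists n, ns_inv f x = it n x}.
  apply: filterS (ns_ae (ns_sym f) f1) => x /= [n]; rewrite ns_invK => E.
  by exists (- n); rewrite [X in it _ X]E ns_itK.
apply: filterS3 ft (ae_orbit t f1) (ae_orbit t f2) => x fx H1 H2; split=> // n.
  by have [m ->] := H1 n; exists (m + n); rewrite ns_itD.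
by have [m ->] := H2 n; exists (m + n); rewrite ns_itD.
Qed.

Lemma ae_good f : nscom f -> {ae mu, forall x, good f x}.
Proof. by move=> [/ae_full_good]. Qed.

Lemma good_nsfull f : {ae mu, forall x, good f x} ->
  {ae mu, forall x, exists n, f x = it n x}.
Proof. by apply: filterS => x [_ /(_ 0)[m fm]] _; exists m. Qed.

Definition nice f (x : X) : Prop := good f x /\ is_symZN (phi f x).

Lemma ae_nice f : nscom f -> {ae mu, forall x, nice f x}.
Proof. by move=> cf; apply: filterS2 (ae_good cf) cf.2. Qed.

Lemma nice_nscom f : {ae mu, forall x, nice f x} -> nscom f.
Proof.
by move=> nf; split; [apply: good_nsfull|]; apply: filterS nf => x [].
Qed.

Lemma nscom_id : nscom (ns_id mu).
Proof.
apply: nice_nscom; apply: filterS ft => x fx; split; first exact: good_id.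
by rewrite (_ : phi _ x = id); [exact: is_symZN_id|apply/funext => n; exact: phi_id].
Qed.

Lemma nscom_t : nscom t.
Proof.
apply: nice_nscom; apply: filterS ft => x fx; split; first exact: good_t.
by rewrite phi_t//; exact: is_symZN_shift.
Qed.

Lemma nscom_sym f : nscom f -> nscom (ns_sym f).
Proof.
move=> /ae_nice nf; apply: nice_nscom; apply: filterS nf => x [gf sf].
by split; [exact: good_sym|exact: symZN_sym].
Qed.

Lemma nscom_comp f g : nscom f -> nscom g -> nscom (ns_comp f g).
Proof.
move=> /ae_nice nf /ae_nice ng; apply: nice_nscom.
apply: filterS2 nf ng => x [gf sf] [gg sg]; split; first exact: good_comp.
by rewrite phi_comp//; exact: is_symZN_comp.
Qed.

End FullGroup.

(** * The commensurating full group and its index *)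

Lemma to_symZNE (s : int -> int) : is_symZN s -> sym_fun (to_symZN s) = s.
Proof. by rewrite /to_symZN; case: pselect. Qed.

Section Index.
Context (R : realType) (d : measure_display) (X : measurableType d).
Variables (mu : probability X R) (t : nsbij mu) (E : nat -> set X).
Context (ft : {ae mu, forall x, free t x}) (et : ergodic_map t) (sE : separating E).
Implicit Types f g : nsbij mu.
Local Notation it := (ns_it t).
Local Notation phi := (phi t).
Local Notation good := (good t).
Local Notation nice := (nice t).
Local Notation nscom := (nscom t).
Local Notation half := (half t).

Lemma pos_ae_sub (A : set X) (P : X -> Prop) : measurable A -> (0 < mu A)%E ->
  {ae mu, forall x, P x} ->
  exists B, [/\ measurable B, B `<=` A, (0 < mu B)%E & forall x, B x -> P x].
Proof.
move=> mA A0 [N [mN N0 PN]]; exists (A `\` N); split.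
- exact: measurableD.
- by move=> x [].
- rewrite measureD//; last by rewrite -ge0_fin_numE// fin_num_measure.
  rewrite (_ : _ (A `&` N) = 0%E) ?sube0//.
  by apply: (@subset_measure0 _ _ _ _ _ N) => //; exact: measurableI.
- by move=> x [_ Nx]; apply: contrapT => /PN.
Qed.

Lemma half_measurable f n : measurable [set x | (f @` half x) (it n x)].
Proof.
rewrite (_ : [set x | _] = [set x | exists m : nat, f (it m x) = it n x]).
  apply: countable_bigcup_measurable => m; apply: (eq_fun_measurable sE).
    by apply: measurableT_comp; [exact: ns_meas|exact: ns_it_measurable].
  exact: ns_it_measurable.
apply/seteqP; split=> [x [_ [[m|//] _ <-] fm]|x [m fm]]; first by exists m.
by exists (it m x) => //; exists m%:Z.
Qed.

(** By commensuration almost every crossing pattern [(J, K)] is a pair of finite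
    sets; there are countably many such pairs, so one of them occurs on a set of
    positive measure. *)
Lemma pattern f : nscom f -> exists (A : set X) (J K : {fset int}),
  [/\ measurable A, (0 < mu A)%E, (forall x, A x -> nice f x),
    (forall x, A x -> natZ `\` phi f x @` natZ = [set` J]) &
    (forall x, A x -> phi f x @` natZ `\` natZ = [set` K])].
Proof.
move=> cf; pose F (JK : {fset int} * {fset int}) := [set x | forall n,
  (n \in JK.1 <-> natZ n /\ ~ (f @` half x) (it n x)) /\
  (n \in JK.2 <-> (f @` half x) (it n x) /\ ~ natZ n)].
have mF JK : measurable (F JK).
  apply: countable_bigcap_measurable => n.
  have mP (P : Prop) := prop_measurable X P; have mh := half_measurable f n.
  apply: measurableI; apply: (iff_measurable (mP _)).
    exact: (measurableI _ _ (mP (natZ n)) (measurableC mh)).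
  exact: (measurableI _ _ mh (mP (~ natZ n))).
have X0 : (0 < mu setT)%E by rewrite probability_setT lte_fin.
have cov : {ae mu, forall x, setT x -> exists JK, F JK x}.
  apply: filterS (ae_nice ft cf) => x [gf sf] _.
  have [fJ fK] : finite_set (natZ `\` phi f x @` natZ) /\ finite_set (phi f x @` natZ `\` natZ).
    by have := sf.2; rewrite /Comm /= /setY finite_setU => -[].
  exists (fset_set (natZ `\` phi f x @` natZ), fset_set (phi f x @` natZ `\` natZ)) => n.
  rewrite [(_, _).1]/(fst _) [(_, _).2]/(snd _) !half_phi// !in_fset_set//.
  by split; split=> [/set_mem//|?]; exact: mem_set.
have [[J K]] := pos_countable_cover (@measurableT _ X) X0 mF cov.
rewrite setTI => F0; have [A [mA AF A0 An]] := pos_ae_sub (mF _) F0 (ae_nice ft cf).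
exists A, J, K; split=> // x Ax; have [gf _] := An _ Ax; apply/seteqP.
  by split=> n; have [] := AF _ Ax n; rewrite half_phi// => H _; move/H.
by split=> n; have [] := AF _ Ax n; rewrite half_phi// => _ H; move/H.
Qed.

Lemma sym_index_pattern f x (J K : {fset int}) :
  natZ `\` phi f x @` natZ = [set` J] -> phi f x @` natZ `\` natZ = [set` K] ->
  sym_index (phi f x) = #|` J|%:Z - #|` K|%:Z.
Proof. by move=> JE KE; rewrite /sym_index JE KE !set_fsetK. Qed.

(** Moving the base point along the orbit conjugates [phi f x] by the shift. *)
Lemma sym_index_step f x : nice f x -> nice f (it 1 x) ->
  sym_index (phi f (it 1 x)) = sym_index (phi f x).
Proof.
move=> [gf sf] [_ sf1].
have : shift \o phi f (it 1 x) = phi f x \o shift.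
  by apply/funext => n; rewrite -[LHS]/(shift (phi f (it 1 x) n)) phi_orbit// /shift subrK.
move=> /(congr1 sym_index); rewrite !sym_index_comp//; [|exact: is_symZN_shift..].
by rewrite sym_index_shift addrC => /addIr.
Qed.

(** The index is constant along orbits, and almost every orbit meets a set on
    which the crossing pattern is fixed. *)
Lemma ae_index f : nscom f ->
  exists k, {ae mu, forall x, sym_index (phi f x) = k}.
Proof.
move=> cf; have [A [J [K [mA A0 An AJ AK]]]] := pattern cf.
exists (#|` J|%:Z - #|` K|%:Z).
apply: filterS2 (ergodic_hit et mA A0) (ae_orbit t (ae_nice ft cf)) => x [n An'] nx.
rewrite -(sym_index_pattern (AJ _ An') (AK _ An')) {An'}.
have step m : sym_index (phi f (it (m + 1) x)) = sym_index (phi f (it m x)).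
  by rewrite addrC ns_itD sym_index_step// -ns_itD.
elim/int_rect: n => [//|n IH|n IH]; first by rewrite -addn1 PoszD step.
by rewrite IH -(step (- n.+1%:Z)); congr (sym_index (phi f (it _ x))); lia.
Qed.

End Index.

Section ComIndex.
Context (R : realType) (d : measure_display) (X : measurableType d).
Variables (mu : probability X R) (T : Aut mu) (E : nat -> set X).
Local Notation t := (repr T).
Context (ft : {ae mu, forall x, free t x}) (et : ergodic_map t) (sE : separating E).
Implicit Types f g : nsbij mu.
Local Notation it := (ns_it t).
Local Notation phi := (phi t).
Local Notation nice := (nice t).
Local Notation nscom := (nscom t).
Local Notation G := (com_full_group T).

Lemma Phi_funE S : Phi_fun T S = phi (repr S).
Proof. by []. Qed.

Local Open Scope quotient_scope.

Lemma com_full_pi f : nscom f -> G (\pi_(Aut mu) f).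
Proof. by apply: nscom_ext; apply: filterS (aut_repr f) => x ->. Qed.

Lemma repr_mulg (S S' : Aut mu) :
  {ae mu, forall x, repr (S * S')%g x = ns_comp (repr S) (repr S') x}.
Proof. exact: aut_repr. Qed.

Lemma com_full1 : G 1%g.
Proof. exact/com_full_pi/nscom_id. Qed.

Lemma com_fullM S S' : G S -> G S' -> G (S * S')%g.
Proof. by move=> gS gS'; apply/com_full_pi/nscom_comp. Qed.

Lemma com_fullV S : G S -> G (S^-1)%g.
Proof. by move=> gS; apply/com_full_pi/nscom_sym. Qed.

Lemma com_fullT : G T.
Proof. exact: (nscom_t ft). Qed.

Lemma com_fullX S n : G S -> G (S ^+ n)%g.
Proof. by move=> gS; elim: n => [|n IH]; [exact: com_full1|rewrite expgS; exact: com_fullM]. Qed.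

Lemma com_index_eq S k : G S ->
  {ae mu, forall x, sym_index (phi (repr S) x) = k} -> com_index T S = k.
Proof.
move=> gS Sk.
have H : {ae mu, forall x, sym_index (Phi T S x) = sym_index (phi (repr S) x)}.
  by apply: filterS (ae_nice ft gS) => x [_ sf]; rewrite /Phi to_symZNE.
apply: xget_unique => [|m Sm]; first by apply: filterS2 H Sk => x -> .
have [x [Hx [<- <-]]] := ae_ex (ae_and H (ae_and Sk Sm)).
exact: Hx.
Qed.

Lemma com_indexP S : G S ->
  {ae mu, forall x, sym_index (phi (repr S) x) = com_index T S}.
Proof.
by move=> gS; have [k kS] := ae_index ft et sE gS; rewrite (com_index_eq gS kS).
Qed.

Lemma phi_mulg S S' : G S -> G S' ->
  {ae mu, forall x, phi (repr (S * S')%g) x = phi (repr S) x \o phi (repr S') x}.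
Proof.
move=> /(ae_good ft) gS /(ae_good ft) gS'.
apply: filterS3 gS gS' (ae_ext t (repr_mulg S S')) => x gS gS' /phi_ext ->.
exact: phi_comp.
Qed.

Lemma com_indexM S S' : G S -> G S' ->
  com_index T (S * S')%g = com_index T S + com_index T S'.
Proof.
move=> gS gS'; apply: com_index_eq; first exact: com_fullM.
have nSS' := ae_and (ae_nice ft gS) (ae_nice ft gS').
have iSS' := ae_and (com_indexP gS) (com_indexP gS').
apply: filterS3 nSS' iSS' (phi_mulg gS gS') => x [[_ sS] [_ sS']] [<- <-] ->.
exact: sym_index_comp.
Qed.

Lemma com_index1 : com_index T 1%g = 0.
Proof. by have := com_indexM com_full1 com_full1; rewrite mulg1; lia. Qed.

Lemma com_indexV S : G S -> com_index T (S^-1)%g = - com_index T S.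
Proof.
move=> gS; have := com_indexM gS (com_fullV gS); rewrite mulgV com_index1; lia.
Qed.

Lemma com_indexT : com_index T T = 1.
Proof.
apply: com_index_eq; first exact: com_fullT.
by apply: filterS ft => x fx; rewrite phi_t// sym_index_shift.
Qed.

Lemma com_indexX S n : G S -> com_index T (S ^+ n)%g = n%:Z * com_index T S.
Proof.
move=> gS; elim: n => [|n IH]; first by rewrite com_index1 mul0r.
by rewrite expgS com_indexM//; [rewrite IH; lia|exact: com_fullX].
Qed.

Lemma com_index_onto (n : int) : exists2 S, G S & com_index T S = n.
Proof.
have gT k := com_fullX k com_fullT; case: n => k.
  by exists (T ^+ k)%g => //; rewrite com_indexX ?com_indexT ?mulr1//; exact: com_fullT.
exists ((T ^+ k.+1)^-1)%g; first exact: com_fullV.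
by rewrite com_indexV// com_indexX ?com_indexT ?mulr1//; exact: com_fullT.
Qed.

End ComIndex.

(** * A metric for the topology of the commensurating full group *)

Lemma finite_int_bound (W : set int) : finite_set W ->
  exists k : nat, forall n, W n -> (absz n <= k)%N.
Proof.
move=> fW; exists (\sum_(n <- fset_set W) absz n)%N => n Wn.
have nW : n \in fset_set W by rewrite in_fset_set// inE.
by rewrite (big_rem _ nW) /=; exact: leq_addr.
Qed.

Definition int_ball (k : nat) : seq int := [seq i%:Z - k%:Z | i <- iota 0 k.*2.+1].

Lemma mem_int_ball (k : nat) (n : int) : (n \in int_ball k) = (absz n <= k)%N.
Proof.
apply/mapP/idP => [[i]|nk]; first by rewrite mem_iota => ? ->; lia.
by exists (absz (n + k%:Z)%R); [rewrite mem_iota|]; lia.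
Qed.

(** Outside of a window all sets of the family coincide with [natZ]. A permutation
    preserving the half-lines that start in the window fixes each of its points
    and preserves both its sides. *)
Lemma stab_window (F : set (set int)) : finite_set F -> F `<=` Comm ->
  exists k : nat, forall s : symZN,
    (forall m : int, (absz m <= k)%N -> forall n : int, m <= n <-> m <= s n) -> sym_stab F s.
Proof.
move=> fF FC; have [k Hk] := finite_int_bound (bigcup_finite fF FC).
exists k.+1 => s Hs M FM.
have bs : bijective s by case: (symP s).
have MN n : (k < absz n)%N -> M n <-> 0 <= n.
  move=> kn; have nW : ~ (M `+` natZ) n by move=> Mn; have := Hk n (ex_intro2 _ _ M FM Mn); lia.
  split=> Mn; apply: contrapT => Nn; apply: nW; [by left|by right].
suff H n : M n <-> M (s n).
  apply/seteqP; split=> [_ [n Mn <-]|n Mn]; first exact: (H n).1.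
  by case: bs => u us su; exists (u n); [apply: (H _).2; rewrite su|exact: su].
have [nk|kn] := leqP (absz n) k.
  suff -> : s n = n by [].
  have [h1 _] : n <= n <-> n <= s n by apply: Hs; lia.
  have [_ h2] : n + 1 <= n <-> n + 1 <= s n by apply: Hs; lia.
  apply/eqP; rewrite eq_le h1// andbT leNgt; apply/negP => ns.
  have ns1 : n + 1 <= s n by lia.
  by have := h2 ns1; lia.
have [n0|n0] := leP 0 n.
  have [+ _] : k.+1%:Z <= n <-> k.+1%:Z <= s n by apply: Hs.
  by move=> h; rewrite !MN; [split|..]; lia.
have [_ h] : - k%:Z <= n <-> - k%:Z <= s n by apply: Hs; lia.
have sk : s n < - k%:Z by rewrite ltNge; apply/negP => /h; lia.
by rewrite !MN; [split|..]; lia.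
Qed.

Lemma norm_intr_sub (R : realType) (a b : int) :
  `|(a - b)%:~R| = `|(b - a)%:~R| :> R.
Proof. by rewrite !intrB distrC. Qed.

Lemma norm_intr_triangle (R : realType) (a b c : int) :
  `|(a - c)%:~R| <= `|(a - b)%:~R| + `|(b - c)%:~R| :> R.
Proof. by rewrite !intrB; exact: ler_distD. Qed.

Section CutDistance.
Context (R : realType) (d : measure_display) (X : measurableType d).
Variables (mu : probability X R) (T : Aut mu) (E : nat -> set X).
Local Notation t := (repr T).
Context (ft : {ae mu, forall x, free t x}) (et : ergodic_map t) (sE : separating E).
Implicit Types (f g : nsbij mu) (S : Aut mu).
Local Notation it := (ns_it t).
Local Notation phi := (phi t).
Local Notation good := (good t).
Local Notation nice := (nice t).
Local Notation nscom := (nscom t).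
Local Notation half := (half t).
Local Notation G := (com_full_group T).
Local Notation I := (com_index T).

Lemma ns_inj f : injective f.
Proof. exact: can_inj (@ns_funK _ _ _ _ f). Qed.

Lemma image_ns_inj f (A : set X) y : (f @` A) (f y) <-> A y.
Proof. by split=> [[z Az /ns_inj <-]//|Ay]; exists y. Qed.

Definition cutdiff f g : set X := [set x | f @` half x <> g @` half x].

Lemma cutdiff_measurable f g : measurable (cutdiff f g).
Proof.
have mS (h k : nsbij mu) : measurable [set x | h @` half x `<=` k @` half x].
  rewrite (_ : [set x | _] =
      [set x | forall m : nat, exists n : nat, k (it n x) = h (it m x)]).
    apply: countable_bigcap_measurable => m; apply: countable_bigcup_measurable => n.
    by apply: (eq_fun_measurable sE); apply: measurableT_comp;
      (exact: ns_meas || exact: ns_it_measurable).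
  apply/seteqP; split=> [x hk m|x hk _ [_ [[m|//] _ <-] <-]].
    have [|_ [[n|//] _ <-] kn] := hk (h (it m x)); last by exists n.
    by exists (it m x) => //; exists m%:Z.
  by have [n <-] := hk m; exists (it n x) => //; exists n%:Z.
rewrite (_ : cutdiff f g = ~` ([set x | f @` half x `<=` g @` half x] `&`
  [set x | g @` half x `<=` f @` half x])).
  by apply: measurableC; apply: measurableI.
by apply/seteqP; split=> x H; [move=> fg; apply: H; exact/seteqP|move=> fg; apply: H; exact/seteqP].
Qed.

(** Only the half-line starting at [0] is tested, the one starting at [m] being
    tested at another point of the same orbit. *)
Definition dcut (S S' : Aut mu) : R := fine (mu (cutdiff (repr S) (repr S'))).

Lemma dcutE S S' : (dcut S S')%:E = mu (cutdiff (repr S) (repr S')).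
Proof. by rewrite fineK// fin_num_measure//; exact: cutdiff_measurable. Qed.

Lemma dcut_ge0 S S' : 0 <= dcut S S'.
Proof. exact/fine_ge0/measure_ge0. Qed.

Lemma dcut_le1 S S' : dcut S S' <= 1.
Proof. by rewrite -lee_fin dcutE probability_le1//; exact: cutdiff_measurable. Qed.

Lemma dcutC S S' : dcut S S' = dcut S' S.
Proof.
rewrite /dcut; congr (fine (mu _)).
by apply/seteqP; split=> x H /esym.
Qed.

Lemma dcut_triangle S S' S'' : dcut S S'' <= dcut S S' + dcut S' S''.
Proof.
have mc := cutdiff_measurable.
rewrite -lee_fin EFinD !dcutE; apply: le_trans (measureU2 _ (mc _ _) (mc _ _)).
apply: le_measure; rewrite ?inE//; first exact: measurableU.
move=> x /= H; apply: contrapT => /not_orP[/contrapT H1 /contrapT H2].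
by apply: H; rewrite H1.
Qed.

Lemma ae_image_mulg (S S' : Aut mu) :
  {ae mu, forall x, repr (S * S')%g @` half x = repr S @` (repr S' @` half x)}.
Proof.
apply: filterS (ae_ext t (repr_mulg S S')) => x H; rewrite image_comp.
by apply/seteqP; split=> _ [_ [n n0 <-] <-]; exists (it n x); rewrite ?H//; exists n.
Qed.

Lemma dcut_mulg (S S' S'' : Aut mu) : dcut (S * S')%g (S * S'')%g = dcut S' S''.
Proof.
congr fine; apply: ae_eq_measure; [exact: cutdiff_measurable..|].
apply: filterS2 (ae_image_mulg S S') (ae_image_mulg S S'') => x H H'.
rewrite /cutdiff /= H H'; split=> K e; apply: K; first by rewrite e.
apply/seteqP; split=> y Ay; apply/(image_ns_inj (repr S)); [rewrite -e|rewrite e];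
  by exists y.
Qed.

(** If the half-orbits of [x] and [it 1 x] have the same images under both maps,
    so does their difference, which is [x] alone. *)
Lemma dcut_eq0 S S' : G S -> G S' -> dcut S S' = 0 -> S = S'.
Proof.
move=> gS gS' S0; rewrite -(reprK S) -(reprK S'); apply/aut_piP.
have : {ae mu, forall x, ~ cutdiff (repr S) (repr S') x}.
  by apply/ae_notP; [exact: cutdiff_measurable|rewrite -dcutE S0].
move=> /(ae_orbit t); apply: filterS2 ft => x fx H.
have H0 : repr S @` half x = repr S' @` half x by apply: contrapT; exact: (H 0).
have H1 : repr S @` half (it 1 x) = repr S' @` half (it 1 x).
  by apply: contrapT; exact: (H 1).
have [y [n n0 yE] Sy] : (repr S' @` half x) (repr S x).
  by rewrite -H0; exists x => //; exists 0.
have [nE|n1] := eqVneq n 0; first by rewrite -Sy -yE nE.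
have : (repr S @` half (it 1 x)) (repr S x).
  rewrite H1 -Sy; exists y => //; exists (n - 1); first by lia.
  by rewrite -ns_itD subrK.
move=> [z [m m0 zE] /ns_inj zx]; exfalso.
by apply: (fx (m + 1)); [lia|rewrite ns_itD zE].
Qed.

Lemma dcut_index S S' : G S -> G S' -> dcut S S' < 1 -> I S = I S'.
Proof.
move=> gS gS' dS; have mc := cutdiff_measurable (repr S) (repr S').
have mC := measurableC mc.
have C0 : (0 < mu (~` cutdiff (repr S) (repr S')))%E.
  by rewrite probability_setC// -dcutE -EFinB lte_fin subr_gt0.
have [x /contrapT Cx [[[gx _] [gx' _]] [<- <-]]] := pos_ae_ex mC C0
  (ae_and (ae_and (ae_nice ft gS) (ae_nice ft gS'))
   (ae_and (com_indexP ft et sE gS) (com_indexP ft et sE gS'))).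
by rewrite /sym_index (half_phi_eq gx gx').1.
Qed.

(** The index is locally constant, so adding its variation to [dcut] keeps the
    topology; the metric becomes unbounded exactly in the direction of the
    index. *)
Definition com_dist (S S' : Aut mu) : R := `|(I S - I S')%:~R| + dcut S S'.

Lemma com_dist_metric : metric_on G com_dist.
Proof.
split=> [g h gg gh|g h gg gh|g h gg gh|g h k gg gh gk].
- by rewrite addr_ge0 ?dcut_ge0.
- split=> [|<-]; last first.
    rewrite /com_dist subrr normr0 add0r /dcut (_ : cutdiff _ _ = set0) ?measure0//.
    by apply/seteqP; split=> // x; apply.
  move/eqP; rewrite paddr_eq0 ?dcut_ge0// => /andP[_ /eqP]; exact: dcut_eq0.
- rewrite /com_dist (dcutC g h); move: (I g) (I h) => a b.
  by rewrite norm_intr_sub.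
- have := dcut_triangle g h k; rewrite /com_dist.
  move: (I g) (I h) (I k) => a b c H.
  by rewrite addrACA; apply: lerD => //; exact: norm_intr_triangle.
Qed.

Lemma com_dist_invariant : left_invariant G com_dist.
Proof.
move=> g h k gg gh gk; rewrite /com_dist dcut_mulg !(com_indexM ft et sE)//.
by congr (`| _%:~R| + _); lia.
Qed.

Lemma com_nbhsE S (P : set (Aut mu)) : com_nbhs T S P <->
  exists (U : set symZN) (e : R), [/\ nbhs (1%g : symZN) U, 0 < e &
    forall h : Aut mu, G h -> measure_lt mu [set x | ~ U ((Phi T S x)^-1 * Phi T h x)%g] e -> P h].
Proof.
split=> [|[U [e [U1 e0 UP]]]].
  rewrite /com_nbhs /within /= nbhsE; case=> W [[B oB <-] BS] WP.
  have [U [e [U1 e0 UB]]] : nbhs (Phi T S) B by exact: open_nbhs_nbhs.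
  by exists U, e; split=> // h gh hU; apply: WP => //; exact: UB.
pose V := [set g : L0sym mu | measure_lt mu [set x | ~ U ((Phi T S x)^-1 * g x)%g] e].
have VS : nbhs (S : initial_topology (Phi T)) (Phi T @^-1` V).
  by apply: (@initial_continuous _ _ (Phi T) S V); exists U, e; split.
rewrite /com_nbhs /within /=; apply: filterS VS => h hV gh; exact: UP.
Qed.

(** Agreement at [it m x] says that the permutation comparing [g] to [f] along the
    orbit of [x] preserves the half-line starting at [m]. *)
Lemma cut_conj f g x m n : good f x -> good g x -> ~ cutdiff f g (it m x) ->
  m <= n <-> m <= phi (ns_sym f) x (phi g x n).
Proof.
move=> gf gg /contrapT E'; have fx : free t x by case: gf.
set s := phi (ns_sym f) x _.
have fs : f (it s x) = g (it n x) by rewrite -(phiE _ gf) phi_Ksym// phiE.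
split=> /(half_orbit _ _ fx) h; apply/(half_orbit _ _ fx).
  by apply/(image_ns_inj f); rewrite fs E'; exact/image_ns_inj.
by apply/(image_ns_inj g); rewrite -E' -fs; exact/image_ns_inj.
Qed.

Lemma Phi_conj S S' x n : nice (repr S) x -> nice (repr S') x ->
  ((Phi T S x)^-1 * Phi T S' x)%g n = phi (ns_sym (repr S)) x (phi (repr S') x n).
Proof.
move=> [gx sx] [_ sx']; rewrite /= /Phi !to_symZNE// Phi_funE.
by rewrite -{1}(phi_Ksym gx (_ n)) fun_invK//; exact: phi_bij.
Qed.

(** A neighbourhood in the group is defined by finitely many commensurate sets,
    which are stabilized by the stabilizer of finitely many half-lines; these are
    tested by [dcut] at the points [it m x] with [m] in a finite window, at a cost
    controlled by nonsingularity. *)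
Lemma com_dist_compatible : compatible G (com_nbhs T) com_dist.
Proof.
move=> g gg P; rewrite com_nbhsE; split; last first.
  move=> [e e0 eP]; exists (sym_stab [set natZ]), (Num.min e 1); split.
  - exists [set natZ]; split=> [|_ ->|s]; first exact: finite_set1.
      by rewrite /Comm /= setYK.
    by rewrite invg1 mul1g.
  - by rewrite lt_min e0/=.
  move=> h gh [B [mB SB Be]]; apply: eP => //.
  have : dcut g h < Num.min e 1.
    rewrite -lte_fin dcutE; apply: le_lt_trans Be.
    apply: ae_le_measure => //; first exact: cutdiff_measurable.
    apply: filterS2 (ae_nice ft gg) (ae_nice ft gh) => x nx nx' cx.
    apply: SB => /= /(_ _ erefl) H; apply: cx.
    have [gx _] := nx; have [gx' _] := nx'.
    apply/half_phi_eq => //; rewrite -[in LHS]H image_comp.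
    apply: eq_imagel => n _ /=.
    by rewrite -[RHS](phi_Ksym gx) -Phi_conj.
  rewrite lt_min => /andP[dg d1].
  by rewrite /com_dist (dcut_index gg gh d1) subrr normr0 add0r.
move=> [U [e [[F [fF FC FU]] e0 UP]]].
have [k Hk] := stab_window fF FC.
have [dl dl0 Hdl] := abs_cont_window t (int_ball k) e0.
exists dl => // h gh dgh; apply: UP => //.
have mc := cutdiff_measurable (repr g) (repr h).
have cdl : (mu (cutdiff (repr g) (repr h)) < dl%:E)%E.
  by rewrite -dcutE lte_fin; apply: le_lt_trans dgh; rewrite lerDr.
have [N [mN N0 NP]] := ae_and (ae_nice ft gg) (ae_nice ft gh).
pose W := [set x | exists n, n \in int_ball k /\ cutdiff (repr g) (repr h) (it n x)].
have mW : measurable W.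
  apply: countable_bigcup_measurable => n; apply: measurableI.
    exact: prop_measurable.
  exact: ns_it_preim_measurable.
exists (N `|` W); split; first exact: measurableU.
  move=> x nUx; apply: contrapT => /not_orP[Nx Wx]; apply: nUx; apply: FU.
  rewrite invg1 mul1g; have [ng nh] : nice (repr g) x /\ nice (repr h) x.
    by apply: contrapT => /NP.
  apply: Hk => m mk n; rewrite Phi_conj//; apply: cut_conj => //; first exact: ng.1.
    exact: nh.1.
  by move=> cm; apply: Wx; exists m; split=> //; rewrite mem_int_ball.
apply: (le_lt_trans (measureU2 _ mN mW)).
by rewrite [X in (X + _)%E](_ : _ = 0%E)// add0e; exact: Hdl.
Qed.

End CutDistance.

(** * Bringing an element of index zero to cuts on a set of positive measure *)

Lemma finite_int_ball (k : nat) : finite_set [set n : int | (absz n <= k)%N].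
Proof.
rewrite (_ : [set n | _] = [set` int_ball k]); first exact: finite_seq.
by apply/seteqP; split=> n; rewrite /= mem_int_ball.
Qed.

Lemma crossing_finite (s : int -> int) : is_symZN s ->
  finite_set [set n | ~ (0 <= n <-> 0 <= s n)].
Proof.
move=> [[u su us] sN]; set D := [set n | _].
have -> : D = u @` (s @` D).
  by rewrite image_comp (_ : u \o s = id) ?image_id//; apply/funext => n /=.
apply: finite_image; apply: sub_finite_set sN => _ [n Dn <-].
have [n0|n0] := boolP (0 <= n).
  by left; split; [exists n|move=> sn0; apply: Dn].
right; split; last by move=> [m m0 /(can_inj su) mn]; move: n0; rewrite -mn m0.
by apply: contrapT => sn0; apply: Dn; split=> // n0'; rewrite n0' in n0.
Qed.

Lemma symZN_crossing (s : int -> int) : bijective s ->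
  finite_set [set n | ~ (0 <= n <-> 0 <= s n)] -> is_symZN s.
Proof.
move=> bs; split=> //; case: (bs) => u su us.
apply: (@sub_finite_set _ _ (s @` [set n | ~ (0 <= n <-> 0 <= s n)])); last exact: finite_image.
move=> m [[[n n0 <-] sn0]|[m0 nm]].
  by exists n => // -[/(_ n0)].
by exists (u m) => //= -[_]; rewrite us => /(_ m0) um0; apply: nm; exists (u m).
Qed.

Lemma swap_fsets (J K : {fset int}) : #|` J| = #|` K| ->
  (forall n, n \in J -> n \notin K) ->
  exists r : int -> int, [/\ involutive r, forall n, n \in J -> r n \in K,
    forall n, n \in K -> r n \in J & forall n, n \notin J -> n \notin K -> r n = n].
Proof.
move=> JK dJK.
pose r n := if n \in J then nth 0 (K : seq int) (index n (J : seq int))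
  else if n \in K then nth 0 (J : seq int) (index n (K : seq int)) else n.
have rJ n : n \in J -> r n \in K.
  by move=> nJ; rewrite /r nJ mem_nth// -JK index_mem.
have dKJ n : n \in K -> (n \in J) = false.
  by move=> nK; apply/negP => /dJK; rewrite nK.
have rK n : n \in K -> r n \in J.
  by move=> nK; rewrite /r dKJ// nK mem_nth// JK index_mem.
exists r; split=> // [n|n nJ nK]; last by rewrite /r (negbTE nJ) (negbTE nK).
have [nJ|nJ] := boolP (n \in J).
  rewrite {1}/r dKJ ?rJ//; rewrite {1}/r nJ index_uniq ?nth_index ?fset_uniq// -?JK ?index_mem//.
have [nK|nK] := boolP (n \in K).
  by rewrite {1}/r rK// {1}/r (negbTE nJ) nK index_uniq ?nth_index ?fset_uniq// ?JK ?index_mem.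
by rewrite /r (negbTE nJ) (negbTE nK) (negbTE nJ) (negbTE nK).
Qed.

Section Cuts.
Context (R : realType) (d : measure_display) (X : measurableType d).
Variables (mu : probability X R) (t : nsbij mu).
Implicit Types f g : nsbij mu.
Local Notation it := (ns_it t).
Local Notation phi := (phi t).
Local Notation good := (good t).

(** [f] preserves the half-orbit of [x]. *)
Definition cut f (x : X) : Prop := forall n, 0 <= n <-> 0 <= phi f x n.

Lemma cut_half f x : good f x -> cut f x -> f @` half t x = half t x.
Proof.
move=> gf cx; apply/seteqP; split=> [_ [_ [n n0 <-] <-]|_ [n n0 <-]].
  by rewrite -phiE//; exists (phi f x n) => //; exact: (cx n).1.
rewrite -(phi_Ksym gf n) phiE//; exists (it (phi (ns_sym f) x n) x) => //.
by exists (phi (ns_sym f) x n) => //; apply: (cx _).2; rewrite phi_Ksym.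
Qed.

Lemma cut_orbit f x j : good f x -> cut f (it j x) <-> forall n, j <= n <-> j <= phi f x n.
Proof.
move=> gf; split=> [cj n|H n].
  have := cj (n - j); rewrite phi_orbit// subrK => -[h1 h2].
  by split=> h; [have := h1 _|have := h2 _]; lia.
rewrite phi_orbit// subr_ge0; have [h1 h2] := H (n + j).
split=> h; first by apply: h1; lia.
by have := h2 h; lia.
Qed.

(** Being piecewise a power of [t], such a map is nonsingular. *)
Lemma orbit_involution (c : X -> int) : (forall n, measurable [set y | c y = n]) ->
  involutive (fun y => it (c y) y) -> exists f, forall y, f y = it (c y) y.
Proof.
move=> mc inv; set P := fun y => it (c y) y.
have mP (C : set X) : measurable C -> measurable (P @^-1` C).
  move=> mC; rewrite (_ : P @^-1` C = [set y | exists n, [set y | c y = n /\ C (it n y)] y]).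
    apply: countable_bigcup_measurable => n; apply: measurableI; first exact: mc.
    exact: ns_it_preim_measurable.
  by apply/seteqP; split=> [y Cy|y [n [<-]]//]; exists (c y).
have P0 (C : set X) : measurable C -> mu C = 0%E -> mu (P @^-1` C) = 0%E.
  move=> mC C0; apply: (measure0_countable_cover (F := fun n => it n @^-1` C)).
  - exact: mP.
  - by move=> n; exact: ns_it_preim_measurable.
  - by move=> n; exact/ns_it_null.
  - by apply: aeW => y Cy; exists (c y).
have mfP : measurable_fun setT P by move=> _ C mC; rewrite setTI; exact: mP.
have PP (C : set X) : measurable C -> mu (P @^-1` C) = 0%E <-> mu C = 0%E.
  move=> mC; split=> [/(P0 _ (mP _ mC))|]; last exact: P0.
  by rewrite (_ : P @^-1` _ = C)//; apply/seteqP; split=> y /=; rewrite [P (P y)]inv.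
by exists (NSBij (inv : cancel P P) inv mfP mfP PP).
Qed.

(** The windows of radius [M] around the points of [B] are pairwise disjoint, so
    that [r] can be performed in all of them simultaneously. *)
Lemma window_swap (B : set X) (M : nat) (r : int -> int) : measurable B ->
  involutive r -> (forall n, (absz n <= M)%N -> (absz (r n) <= M)%N) ->
  (forall x n, (absz n <= M.*2)%N -> n != 0 -> B x -> ~ B (it n x)) ->
  exists f, (forall x n, B x -> (absz n <= M)%N -> f (it n x) = it (r n) x) /\
    (forall y, (forall n, (absz n <= M)%N -> ~ B (it n y)) -> f y = y).
Proof.
move=> mB rr rM dB.
pose key y n := (absz n <= M)%N /\ B (it (- n) y).
have keyU y m n : key y m -> key y n -> m = n.
  move=> [mM Bm] [nM]; rewrite (_ : - n = (m - n) + - m); last by lia.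
  rewrite ns_itD => Bn; apply: contrapT => /eqP mn.
  by apply: (dB _ (m - n) _ _ Bm Bn); lia.
pose c y := if pselect (exists n, key y n) is left e then r (sval (cid e)) - sval (cid e) else 0.
have cE y n : key y n -> c y = r n - n.
  move=> kn; rewrite /c; case: pselect => [e|[]]; last by exists n.
  by case: (cid e) => m km /=; rewrite (keyU _ _ _ kn km).
have c0 y : ~ (exists n, key y n) -> c y = 0 by rewrite /c; case: pselect.
have mkey n : measurable [set y | key y n].
  by apply: measurableI; [exact: prop_measurable|exact: ns_it_preim_measurable].
have mc m : measurable [set y | c y = m].
  rewrite (_ : [set y | _] = [set y | exists n, [set y | key y n /\ r n - n = m] y] `|`
      [set y | ~ (exists n, key y n) /\ 0 = m]).
    apply: measurableU.
      apply: countable_bigcup_measurable => n; apply: measurableI; first exact: mkey.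
      exact: prop_measurable.
    apply: measurableI; last exact: prop_measurable.
    exact/measurableC/countable_bigcup_measurable.
  apply/seteqP; split=> [y /= <-|y [[n [kn <-]]|[nk <-]]].
  - have [[n kn]|nk] := pselect (exists n, key y n).
      by left; exists n; split=> //; rewrite (cE y n).
    by right; split=> //; rewrite c0.
  - exact: cE.
  - exact: c0.
have fB x n : B x -> (absz n <= M)%N -> it (c (it n x)) (it n x) = it (r n) x.
  move=> Bx nM; rewrite (cE _ n); last by split=> //; rewrite ns_itK.
  by rewrite -ns_itD subrK.
have fN y : ~ (exists n, key y n) -> it (c y) y = y by move=> nk; rewrite c0.
have [|f fE] := @orbit_involution c mc.
  move=> y; have [[n [nM Bn]]|nk] := pselect (exists n, key y n); last by rewrite !fN.
  have [x [-> Bx]] : exists x, y = it n x /\ B x by exists (it (- n) y); rewrite ns_itVK.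
  by rewrite (fB _ _ Bx nM) (fB _ _ Bx (rM _ nM)) rr.
exists f; split=> [x n Bx nM|y nB]; first by rewrite fE fB.
by rewrite fE fN// => -[n [nM]]; apply: nB; rewrite abszN.
Qed.

End Cuts.

Section CutAfterSwap.
Context (R : realType) (d : measure_display) (X : measurableType d).
Variables (mu : probability X R) (t : nsbij mu) (E : nat -> set X).
Context (ft : {ae mu, forall x, free t x}) (et : ergodic_map t) (sE : separating E)
  (hmu : atomless mu).
Implicit Types f g : nsbij mu.
Local Notation it := (ns_it t).
Local Notation phi := (phi t).
Local Notation nscom := (nscom t).
Local Notation nice := (nice t).
Local Notation cut := (cut t).

(** By countability of the possible crossing patterns, on a set of positive
    measure [phi f x @` natZ] is a fixed set [natZ `\` J `|` K], and [J] and [K]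
    have as many elements since the index vanishes. Exchanging [J] and [K] along
    disjoint windows over a small subset [B] of this set restores the half-orbits
    of the points of [B]. *)
Lemma cut_after_swap f (e : R) : nscom f ->
  {ae mu, forall x, sym_index (phi f x) = 0} -> 0 < e ->
  exists (p : nsbij mu) (B W : set X), [/\ nscom p /\ involutive p,
    measurable B /\ (0 < mu B)%E, {ae mu, forall x, B x -> cut (ns_comp p f) x},
    measurable W /\ (mu W < e%:E)%E & {ae mu, forall x, ~ W x -> cut p x}].
Proof.
move=> cf if0 e0; have [A [J [K [mA A0 An AJ AK]]]] := pattern ft sE cf.
have [x0 Ax0 ix0] := pos_ae_ex mA A0 if0.
have J0 n : n \in J -> 0 <= n.
  by move=> nJ; have : [set` J] n by []; rewrite -(AJ _ Ax0) => -[].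
have K0 n : n \in K -> n < 0.
  move=> nK; have : [set` K] n by []; rewrite -(AK _ Ax0) => -[_ nn].
  by rewrite ltNge; apply/negP => ?; apply: nn.
have JK : #|` J| = #|` K|.
  by move: ix0; rewrite (sym_index_pattern (AJ _ Ax0) (AK _ Ax0)); lia.
have [r [rr rJ rK r_id]] : exists r : int -> int, [/\ involutive r, forall n, n \in J -> r n \in K,
    forall n, n \in K -> r n \in J & forall n, n \notin J -> n \notin K -> r n = n].
  by apply: swap_fsets => // n /J0 n0; apply/negP => /K0; lia.
have [M HM] : exists M : nat, forall n, n \in J \/ n \in K -> (absz n <= M)%N.
  have [|M HM] := @finite_int_bound ([set` J] `|` [set` K]).
    by rewrite finite_setU; split; exact: finite_fset.
  by exists M.
have rM n : (absz n <= M)%N -> (absz (r n) <= M)%N.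
  move=> nM; have [nJ|nJ] := boolP (n \in J); first by apply: HM; right; exact: rJ.
  have [nK|nK] := boolP (n \in K); first by apply: HM; left; exact: rK.
  by rewrite r_id.
have [B [mB BA B0 Be BD]] := tower_base (int_ball M.*2) sE hmu et mA A0 e0.
set W := [set x | _] in Be.
have mW : measurable W.
  apply: countable_bigcup_measurable => n; apply: measurableI.
    exact: prop_measurable.
  exact: ns_it_preim_measurable.
have dB x n : (absz n <= M.*2)%N -> n != 0 -> B x -> ~ B (it n x).
  by move=> nM; apply: BD; rewrite mem_int_ball.
have [p [pB pN]] := window_swap mB rr rM dB.
have pw y : (exists n, (absz n <= M)%N /\ B (it n y)) \/ p y = y.
  have [?|nB] := pselect (exists n, (absz n <= M)%N /\ B (it n y)); [by left|right].
  by apply: pN => n nM Bn; apply: nB; exists n.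
have pp : involutive p.
  move=> y; have [[n [nM Bn]]|pe] := pw y; last by rewrite !pe.
  have yE : y = it (- n) (it n y) by rewrite ns_itK.
  have nM' : (absz (- n) <= M)%N by rewrite abszN.
  by rewrite {1}yE (pB _ _ Bn nM') (pB _ _ Bn (rM _ nM')) rr -yE.
have pf y : exists n, p y = it n y.
  have [[n [nM Bn]]|->] := pw y; last by exists 0.
  have nM' : (absz (- n) <= M)%N by rewrite abszN.
  exists (r (- n) + n); rewrite ns_itD -(pB _ _ Bn nM') ns_itK//.
have gp x : free t x -> good t p x.
  move=> fx; split=> // n.
    by have [m ->] := pf (it n x); exists (m + n); rewrite ns_itD.
  have [m pm] := pf (it n x); exists (m + n); rewrite ns_itD -pm.
  by rewrite -[in LHS](pp (it n x)) ns_funK.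
have move_p x n : free t x ->
  (exists j, [/\ (absz j <= M)%N, B (it (n - j) x) & phi p x n = n - j + r j]) \/
  phi p x n = n.
  move=> fx; have [[j [jM Bj]]|pe] := pw (it n x); [left|right].
    exists (- j); rewrite abszN opprK addrC ns_itD; split=> //.
    apply: phi_eq; first exact: gp.
    rewrite -(ns_itK t j (it n x)) (pB _ _ Bj) ?abszN// -!ns_itD.
    by congr (it _ x); lia.
  by apply: phi_eq; [exact: gp|rewrite pe].
exists p, B, W; split=> //.
- split=> //; apply: nice_nscom; apply: filterS ft => x fx; split; first exact: gp.
  apply: symZN_crossing; first by apply: phi_bij; exact: gp.
  apply: sub_finite_set (finite_int_ball M.*2) => n /= nc.
  have [[j [jM _ pj]]|pe] := move_p x n fx; last by case: nc; rewrite pe.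
  rewrite leqNgt; apply/negP => nM; apply: nc; rewrite pj.
  by have := rM _ jM; split; lia.
- apply: filterS ft => x fx Bx.
  have Ax := BA _ Bx; have [gx _] := An _ Ax.
  move=> n; rewrite phi_comp//=; last exact: gp.
  set m := phi f x n.
  have mN : 0 <= n <-> (phi f x @` natZ) m.
    split=> [n0|[k k0]]; first by exists n.
    by rewrite /m => /(bij_inj (phi_bij gx)) <-.
  have mJ : m \in J <-> 0 <= m /\ ~ (phi f x @` natZ) m.
    by have -> : (m \in J) = ([set` J] m) :> Prop by []; rewrite -(AJ _ Ax).
  have mK : m \in K <-> (phi f x @` natZ) m /\ ~ 0 <= m.
    by have -> : (m \in K) = ([set` K] m) :> Prop by []; rewrite -(AK _ Ax).
  have [mM|Mm] := leqP (absz m) M.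
    have -> : phi p x m = r m by apply: phi_eq; [exact: gp|exact: pB].
    have [mj|nj] := boolP (m \in J).
      have := K0 _ (rJ _ mj); have [_ nm] := mJ.1 mj; split; last by lia.
      by move/mN.
    have [mk|nk] := boolP (m \in K).
      have := J0 _ (rK _ mk); have [mi _] := mK.1 mk; split=> // _.
      exact/mN.
    rewrite r_id//; split=> [/mN mi|m0].
      by apply: contrapT => nm; move/negP: nk; apply; apply/mK.
    by apply/mN; apply: contrapT => nm; move/negP: nj; apply; apply/mJ.
  (* Beyond [M], a moved point belongs to the window around another point of [B],
     which lies on one side of the window around [x]. *)
  have side : 0 <= phi p x m <-> 0 <= m.
    have [[j [jM Bj ->]]|->] := move_p x m fx; last by [].
    have [mj|mj] := eqVneq (m - j) 0; first by exfalso; lia.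
    have [jM2|jM2] := leqP (absz (m - j)%R) M.*2.
      by exfalso; apply: (BD x (m - j)) => //; rewrite mem_int_ball.
    by have := rM _ jM; split; lia.
  apply: iff_trans (iff_sym side); apply: (iff_trans mN); split=> [mi|m0].
    apply: contrapT => nm; have : m \in K by apply/mK.
    by move=> mk; have := HM m (or_intror mk); lia.
  apply: contrapT => nm; have : m \in J by apply/mJ.
  by move=> mj; have := HM m (or_introl mj); lia.
- apply: filterS ft => x fx nWx n.
  have [[j [jM Bj ->]]|->] := move_p x n fx; last by [].
  have nj : (M.*2 < absz (n - j)%R)%N.
    rewrite ltnNge; apply/negP => njM; apply: nWx; exists (n - j); split=> //.
    by rewrite mem_int_ball.
  by have := rM _ jM; split; lia.
Qed.

End CutAfterSwap.

(** * Splitting an element with recurrent cuts into boundedly many small ones *)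

Section FirstHit.
Context (R : realType) (d : measure_display) (X : measurableType d).
Variables (mu : probability X R) (t : nsbij mu) (E : nat -> set X).
Context (et : ergodic_map t) (sE : separating E) (hmu : atomless mu).
Variable B : set X.
Context (mB : measurable B) (B0 : (0 < mu B)%E).
Local Notation it := (ns_it t).

Definition last_visit (x : X) (k : nat) : Prop :=
  B (it (- k%:Z) x) /\ forall j : nat, (j < k)%N -> ~ B (it (- j%:Z) x).

(** A family describing the intervals between consecutive visits to [B]: it
    consists of preimages of the separating sets under the map sending a point to
    its last visit to [B], where an interval is represented by its first point. *)
Definition last_visit_in (i : nat) : set X :=
  [set x | exists k, last_visit x k /\ E i (it (- k%:Z) x)].

Lemma last_visit_uniq x k k' : last_visit x k -> last_visit x k' -> k = k'.
Proof.
move=> [Bk Hk] [Bk' Hk']; have [kk|kk|//] := ltngtP k k'.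
  by case: (Hk' _ kk Bk).
by case: (Hk _ kk Bk').
Qed.

Lemma last_visit_ex x : (exists k : nat, B (it (- k%:Z) x)) -> exists k, last_visit x k.
Proof.
move=> [k0 Bk0]; have ex : exists k : nat, `[< B (it (- k%:Z) x) >].
  by exists k0; apply/asboolP.
have [k /asboolP Bk kmin] := ex_minnP ex.
by exists k; split=> // j jk /asboolT /kmin; rewrite leqNgt jk.
Qed.

Lemma last_visit_inE x k i : last_visit x k ->
  last_visit_in i x <-> E i (it (- k%:Z) x).
Proof.
move=> xk; split=> [[k' [xk' Ek']]|Ek]; last by exists k.
by rewrite (last_visit_uniq xk xk').
Qed.

Lemma last_visit_in_measurable i : measurable (last_visit_in i).
Proof.
apply: countable_bigcup_measurable => k; apply: measurableI; last first.
  by apply: ns_it_preim_measurable; exact: sE.1.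
apply: measurableI; first exact: ns_it_preim_measurable.
apply: countable_bigcap_measurable => j.
have [jk|jk] := boolP (j < k)%N.
  rewrite (_ : (fun x => _) = ~` (it (- j%:Z) @^-1` B)).
    exact/measurableC/ns_it_preim_measurable.
  by apply/seteqP; split=> x H //; exact: H.
by rewrite (_ : (fun x => _) = setT)//; apply/seteqP; split.
Qed.

Lemma last_visit_in_step i x : ~ B (it 1 x) ->
  last_visit_in i (it 1 x) <-> last_visit_in i x.
Proof.
move=> nB; have S k : it (- k.+1%:Z) (it 1 x) = it (- k%:Z) x.
  by rewrite -ns_itD; congr (it _ x); lia.
split=> [[[|k] [[Bk Hk] Ek]]|[k [[Bk Hk] Ek]]]; first by case: (nB Bk).
  rewrite S in Bk Ek; exists k; split=> //; split=> // j jk.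
  by rewrite -S; exact: (Hk j.+1).
exists k.+1; rewrite /last_visit !S; split=> //; split=> // -[//|j] jk.
by rewrite S; exact: Hk.
Qed.

(** Up to a null set, an atom of the family consists of the points whose last
    visit to [B] is one and the same point; it is contained in a single orbit. *)
Lemma last_visit_atom_null x :
  mu [set y | forall i, last_visit_in i y <-> last_visit_in i x] = 0%E.
Proof.
set Z := [set y | _]; have mZ : measurable Z.
  apply: countable_bigcap_measurable => i; apply: iff_measurable.
    exact: last_visit_in_measurable.
  exact: prop_measurable.
have bh := backward_hit hmu et mB B0.
apply/eqP; rewrite eq_le measure_ge0 andbT leNgt; apply/negP => Z0.
have [y0 Zy0 /last_visit_ex[k0 y0k]] := pos_ae_ex mZ Z0 bh.
suff ZE : mu Z = 0%E by rewrite ZE ltxx in Z0.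
pose b := it (- k0%:Z) y0.
apply: (measure0_countable_cover (F := fun k : nat => [set it k b])) => //.
- by move=> k; have [] := point_null (it k b) sE hmu.
- by move=> k; have [] := point_null (it k b) sE hmu.
apply: filterS bh => y /last_visit_ex[k yk] Zy; exists k.
suff -> : b = it (- k%:Z) y by rewrite ns_itVK.
apply: sE.2 => i.
have h0 := last_visit_inE i y0k; have h := last_visit_inE i yk.
exact: iff_trans (iff_sym h0) (iff_trans (Zy0 i) (iff_trans (iff_sym (Zy i)) h)).
Qed.

End FirstHit.

Section Restriction.
Context (R : realType) (d : measure_display) (X : measurableType d).
Variables (mu : probability X R).
Implicit Types f g : nsbij mu.

Lemma ns_restrict_inv f (D : set X) : measurable D ->
  (forall y, D (f y) <-> D y) ->
  exists h : nsbij mu, forall y, h y = if `[< D y >] then f y else y.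
Proof.
move=> mD fD; have fD' y : D (ns_inv f y) <-> D y.
  by rewrite -[X in _ <-> D X](ns_invK f y) fD.
pose H (g : X -> X) y := if `[< D y >] then g y else y.
have preim (g : nsbij mu) (C : set X) :
    H g @^-1` C = (D `&` g @^-1` C) `|` (~` D `&` C).
  apply/seteqP; split=> y; rewrite /H /=; case: asboolP => Dy; [by left|by right|..].
    by case=> -[].
  by case=> -[].
have mH (g : nsbij mu) (C : set X) : measurable C -> measurable (H g @^-1` C).
  move=> mC; rewrite preim; apply: measurableU; apply: measurableI => //.
    exact: ns_preimage_measurable.
  exact: measurableC.
have H0 (g : nsbij mu) (C : set X) : measurable C -> mu C = 0%E -> mu (H g @^-1` C) = 0%E.
  move=> mC C0.
  apply: (measure0_countable_cover (F := fun b : bool => if b then g @^-1` C else C)).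
  - exact: mH.
  - by case => //; exact: ns_preimage_measurable.
  - by case => //; exact/ns_null.
  - by apply: aeW => y; rewrite preim => -[[_ ?]|[_ ?]]; [exists true|exists false].
have K (g k : nsbij mu) : cancel g k -> (forall y, D (g y) <-> D y) -> cancel (H g) (H k).
  move=> gk gD y; rewrite /H; case: (asboolP (D y)) => Dy.
    by case: asboolP => [_|/gD//]; exact: gk.
  by case: asboolP.
have HK := K f (ns_sym f) (@ns_funK _ _ _ _ f) fD.
have HVK := K (ns_sym f) f (@ns_invK _ _ _ _ f) fD'.
have mfun (g : nsbij mu) : measurable_fun setT (H g).
  by move=> _ C mC; rewrite setTI; exact: mH.
have Hn (C : set X) : measurable C -> mu (H f @^-1` C) = 0%E <-> mu C = 0%E.
  move=> mC; split=> [/(H0 (ns_sym f) _ (mH f _ mC))|]; last exact: H0.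
  by rewrite (_ : _ @^-1` _ = C)//; apply/seteqP; split=> y /=; rewrite HVK.
by exists (NSBij HK HVK (mfun f) (mfun (ns_sym f)) Hn).
Qed.

(** A set which is invariant up to a null set is replaced by the set of points
    whose whole orbit under [f] stays in it, which is invariant. *)
Lemma ns_restrict f (D : set X) : measurable D ->
  {ae mu, forall y, D (f y) <-> D y} ->
  exists h : nsbij mu, {ae mu, forall y, h y = if `[< D y >] then f y else y}.
Proof.
move=> mD fD; pose D' := [set y | forall n, D (ns_it f n y)].
have mD' : measurable D'.
  by apply: countable_bigcap_measurable => n; exact: ns_it_preim_measurable.
have [|h hE] := @ns_restrict_inv f D' mD'.
  move=> y; split=> Dy n.
    by have := Dy (n - 1); rewrite -{1}(ns_it1 f y) -ns_itD subrK.
  by rewrite -(ns_it1 f y) -ns_itD.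
exists h; apply: filterS (ae_orbit f fD) => y H; rewrite hE.
suff -> : `[< D' y >] = `[< D y >] by [].
have step n : D (ns_it f (n + 1) y) <-> D (ns_it f n y) by rewrite ns_itS.
apply: asbool_equiv_eq; split=> [/(_ 0)//|Dy]; elim/int_rect => [//|n IH|n IH].
  by rewrite -addn1 PoszD; apply/step.
by apply/step; rewrite (_ : - n.+1%:Z + 1 = - n%:Z)//; lia.
Qed.

End Restriction.

Section Pieces.
Context (R : realType) (d : measure_display) (X : measurableType d).
Variables (mu : probability X R) (t : nsbij mu).
Context (ft : {ae mu, forall x, free t x}).
Implicit Types f g : nsbij mu.
Local Notation it := (ns_it t).
Local Notation phi := (phi t).
Local Notation nscom := (nscom t).
Local Notation nice := (nice t).
Local Notation good := (good t).
Local Notation cut := (cut t).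
Variables (B : set X) (g : X -> nat).
Context (mg : forall q, measurable [set x | g x = q])
  (gB : forall x, ~ B (it 1 x) -> g (it 1 x) = g x).

Lemma pieces_const x (m n : int) : m <= n ->
  (forall j, m < j -> j <= n -> ~ B (it j x)) -> g (it n x) = g (it m x).
Proof.
move=> mn; have [p ->] : exists p : nat, n = m + p%:Z.
  by exists (absz (n - m)%R); lia.
elim: p => [|p IH] H; first by rewrite addr0.
rewrite -IH; last by move=> j mj jn; apply: H => //; lia.
rewrite (_ : m + p.+1%:Z = 1 + (m + p%:Z)); last by lia.
by rewrite (ns_itD t 1) gB// -ns_itD; apply: H; lia.
Qed.

(** A half-orbit which separates a point from its image is not preserved. *)
Lemma no_cut_between f x n : good f x ->
  (forall j, B (it j x) -> cut f (it j x)) ->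
  forall j, (n < j <= phi f x n) || (phi f x n < j <= n) -> ~ B (it j x).
Proof.
move=> gf H j nj Bj; have [h1 h2] := (cut_orbit j gf).1 (H _ Bj) n.
case/orP: nj => /andP[lt1 le2]; first by have := h2 le2; lia.
by have := h1 le2; lia.
Qed.

Lemma pieces_inv f x n : good f x ->
  (forall j, B (it j x) -> cut f (it j x)) -> g (it (phi f x n) x) = g (it n x).
Proof.
move=> gf H; have nB := no_cut_between gf H (n := n).
have [le|/ltW le] := leP n (phi f x n).
  by apply: pieces_const => // j mj jn; apply: nB; rewrite mj jn.
by apply/esym/pieces_const => // j mj jn; apply: nB; rewrite mj jn orbT.
Qed.

(** The pieces are unions of intervals between visits to [B], which [f] preserves.
    If the restriction brings a point of a piece from one side of [x] to the
    other, then [x] lies in the same interval, hence in the same piece. *)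
Lemma restrict_pieces f (Q : pred nat) : nscom f ->
  {ae mu, forall x, B x -> cut f x} ->
  exists h, [/\ nscom h, {ae mu, forall y, h y = if Q (g y) then f y else y} &
    {ae mu, forall x, ~~ Q (g x) -> cut h x}].
Proof.
move=> cf fB; have nf := ae_nice ft cf; have fBo := ae_orbit t fB.
pose D := [set y | Q (g y)].
have mD : measurable D.
  rewrite (_ : D = [set y | exists q, [set y | g y = q /\ Q q] y]).
    apply: countable_bigcup_measurable => q; apply: measurableI; first exact: mg.
    exact: prop_measurable.
  by apply/seteqP; split=> [y Qy|y [q [<-]]//]; exists (g y).
have [|h hE] := ns_restrict (f := f) mD.
  apply: filterS2 nf fBo => y [gf _] H.
  by rewrite /D /= -[X in f X](ns_it0 t) -phiE// pieces_inv.
have {}hE : {ae mu, forall y, h y = if Q (g y) then f y else y}.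
  by apply: filterS hE => y ->; rewrite /D/= asboolb.
have full : {ae mu, forall y, exists n, h y = it n y}.
  by apply: filterS2 hE cf.1 => y -> [n fn]; case: ifP => _; [exists n|exists 0].
have hphi : {ae mu, forall x, good h x /\
    forall n, phi h x n = if Q (g (it n x)) then phi f x n else n}.
  have gh : {ae mu, forall x, good h x}.
    exact: ae_full_good.
  apply: filterS3 nf gh (ae_orbit t hE) => x [gf _] gh H; split=> // n.
  by apply: phi_eq => //; rewrite H; case: ifP => _ //; rewrite phiE.
exists h; split=> //.
- apply: (nice_nscom); apply: filterS2 nf hphi => x [gf sf] [gh H]; split=> //.
  apply: symZN_crossing; first exact: phi_bij.
  apply: sub_finite_set (crossing_finite sf) => n /=; rewrite H.
  by case: ifP => // _ [].
- apply: filterS3 nf hphi fBo => x [gf _] [gh H] nB Qx n; rewrite H; case: ifP => // Qn.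
  have cb := no_cut_between gf nB (n := n).
  suff same : (0 <= n) = (0 <= phi f x n) by rewrite same.
  apply/idP/idP => n0; rewrite leNgt; apply/negP => n1.
    have gn : g (it n x) = g (it 0 x).
      by apply: pieces_const => // j j0 jn; apply: cb; apply/orP; right; lia.
    by move: Qx; rewrite -(ns_it0 t x) -gn Qn.
  have gn : g (it 0 x) = g (it n x).
    by apply: pieces_const => [|j j0 jn]; [lia|apply: cb; apply/orP; left; lia].
  by move: Qx; rewrite -(ns_it0 t x) gn Qn.
Qed.

End Pieces.

(** * Boundedness of the kernel of the index *)

Section Kernel.
Context (R : realType) (d : measure_display) (X : measurableType d).
Variables (mu : probability X R) (T : Aut mu) (E : nat -> set X).
Local Notation t := (repr T).
Context (ft : {ae mu, forall x, free t x}) (et : ergodic_map t) (sE : separating E)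
  (hmu : atomless mu).
Local Notation it := (ns_it t).
Local Notation phi := (phi t).
Local Notation nscom := (nscom t).
Local Notation cut := (cut t).
Local Notation half := (half t).
Local Notation G := (com_full_group T).
Local Notation I := (com_index T).
Local Open Scope quotient_scope.
Local Notation cls f := (\pi_(Aut mu) f).

Lemma dcut1_le (h : nsbij mu) (W : set X) : nscom h -> measurable W ->
  {ae mu, forall x, ~ W x -> cut h x} -> ((dcut T 1%g (cls h))%:E <= mu W)%E.
Proof.
move=> ch mW hW; rewrite (dcutE T sE).
apply: ae_le_measure => //; first exact: (cutdiff_measurable T sE).
have e1 := ae_ext t (aut_repr (ns_id mu)).
have eh := ae_ext t (aut_repr h).
apply: filterS3 (ae_and e1 eh) (ae_nice ft ch) hW => x [H1 Hh] [gh _] Wx cx.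
apply: contrapT => /Wx cutx; apply: cx.
have -> : repr (1%g : Aut mu) @` half x = half x.
  apply/seteqP; split=> [_ [_ [n n0 <-] <-]|_ [n n0 <-]].
    by rewrite H1; exists n.
  by exists (it n x); [exists n|rewrite H1].
rewrite -[LHS](cut_half gh cutx).
by apply/seteqP; split=> _ [_ [n n0 <-] <-]; exists (it n x); rewrite ?Hh//; exists n.
Qed.

Context (D : Aut mu -> Aut mu -> R).
Context (cD : compatible_left_invariant_metric G (com_nbhs T) D).

Lemma dist_mul S S' : G S -> G S' -> D 1%g (S * S')%g <= D 1%g S + D 1%g S'.
Proof.
have [[_ _ _ tri] inv _] := cD; have g1 := com_full1 ft.
move=> gS gS'; apply: le_trans (tri _ S _ g1 gS _) _; first exact: com_fullM.
by rewrite lerD2l -{1}(mulg1 S) inv.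
Qed.

Lemma unit_ball : exists2 e : R, 0 < e &
  forall h, G h -> dcut T 1%g h < e -> D 1%g h < 1.
Proof.
have [_ _ comp] := cD; have g1 := com_full1 ft.
have : com_nbhs T 1%g [set h | D 1%g h < 1] by apply/(comp _ g1); exists 1.
move=> /(com_dist_compatible ft et sE g1)[e e0 H].
exists (Num.min e 1) => [|h gh]; first by rewrite lt_min e0/=.
rewrite lt_min => /andP[he h1]; apply: H => //.
by rewrite /com_dist (dcut_index ft et sE g1 gh h1) subrr normr0 add0r.
Qed.

(** The intervals between consecutive visits to [B] form a space without atoms,
    which is cut into [N] parts. Since [S] preserves the intervals, it preserves
    the parts and is the product of its restrictions to them, each of which is
    close to the identity. *)
Lemma cut_bounded (e : R) (N : nat) (B : set X) S :
  (forall h, G h -> dcut T 1%g h < e -> D 1%g h < 1) ->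
  (forall F : nat -> set X, (forall i, measurable (F i)) ->
    (forall x, mu [set y | forall i, F i y <-> F i x] = 0%E) ->
    exists g : X -> nat, [/\ forall x, (g x < N)%N,
      forall q, measurable [set x | g x = q],
      forall q, (mu [set x | g x = q] < e%:E)%E &
      forall x y, (forall i, F i x <-> F i y) -> g x = g y]) ->
  measurable B -> (0 < mu B)%E -> G S -> {ae mu, forall x, B x -> cut (repr S) x} ->
  D 1%g S <= N%:R.
Proof.
move=> De HN mB B0 gS cB; set f := repr S.
have [g [gN mg ge gF]] := HN _ (last_visit_in_measurable t sE mB)
  (last_visit_atom_null et sE hmu mB B0).
have gB x : ~ B (it 1 x) -> g (it 1 x) = g x.
  by move=> nB; apply: gF => i; exact: last_visit_in_step.
have gf : {ae mu, forall y, g (f y) = g y}.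
  apply: filterS2 (ae_nice ft gS) (ae_orbit t cB) => y [gfy _] H.
  by rewrite -[X in f X](ns_it0 t) -phiE// (pieces_inv gB).
(* Induction on the number of pieces to which [f] is restricted. *)
suff [h [ch hE hD]] : exists h, [/\ nscom h,
    {ae mu, forall y, h y = if (g y < N)%N then f y else y} & D 1%g (cls h) <= N%:R].
  rewrite (_ : S = cls h)// -(reprK S); apply/aut_piP.
  by apply: filterS hE => y ->; rewrite gN.
elim: N {HN gN} => [|q [h [ch hE hD]]].
  exists (ns_id mu); split; first exact: nscom_id.
    exact: aeW.
  have g1 := com_full1 ft; have [[_ /(_ _ _ g1 g1)[_ D0] _ _] _ _] := cD.
  by rewrite (D0 erefl).
have [k [ck kE kcut]] := restrict_pieces ft mg gB (pred1 q) gS cB.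
exists (ns_comp h k); split; first exact: nscom_comp.
- apply: filterS3 kE gf (ns_ae k hE) => y /= ky gy ->; rewrite ky.
  have [gq|gq] := eqVneq (g y) q; first by rewrite gy gq ltnn leqnn.
  by rewrite (_ : (g y < q.+1)%N = (g y < q)%N)//; apply/idP/idP; lia.
- rewrite -autM_pi; apply: le_trans (dist_mul _ _) _; [exact: com_full_pi..|].
  rewrite -natr1 lerD//; apply/ltW/De; first exact: com_full_pi.
  rewrite -lte_fin; apply: le_lt_trans (ge q).
  by apply: dcut1_le => //; apply: filterS kcut => x H /eqP; exact: H.
Qed.

Lemma kernel_bounded : exists C : R, forall S, G S -> I S = 0 -> D 1%g S <= C.
Proof.
have [e e0 De] := unit_ball; have [N HN] := small_partition mu e0.
exists (1 + N%:R) => S gS iS.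
have i0 : {ae mu, forall x, sym_index (phi (repr S) x) = 0}.
  by rewrite -iS; exact: (com_indexP ft et sE gS).
have [p [B [W [[cp pp] [mB B0] cB [mW We] cW]]]] := cut_after_swap ft et sE hmu gS i0 e0.
have gP : G (cls p) by exact: com_full_pi.
pose S' := (cls p * S)%g; have gS' : G S' by exact: com_fullM.
have SE : S = (cls p * S')%g.
  rewrite /S' mulgA (_ : cls p * cls p = 1)%g ?mul1g//.
  by rewrite [LHS]autM_pi; apply/aut_piP; apply: aeW => x /=; rewrite pp.
rewrite SE; apply: le_trans (dist_mul gP gS') _; apply: lerD.
  apply/ltW/De => //; rewrite -lte_fin; apply: le_lt_trans We.
  exact: dcut1_le.
apply: (cut_bounded De HN mB B0 gS').
have eS' : {ae mu, forall x, repr S' x = ns_comp p (repr S) x}.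
  by apply/aut_piP; rewrite reprK /S' -[in LHS](reprK S); exact: autM_pi.
apply: filterS2 cB (ae_ext t eS') => x H /phi_ext e' Bx.
by move=> n; rewrite e'; exact: H.
Qed.

Lemma dist_expg S n : G S -> D 1%g (S ^+ n)%g <= n%:R * D 1%g S.
Proof.
move=> gS; elim: n => [|n IH].
  have g1 := com_full1 ft; have [[_ /(_ _ _ g1 g1)[_ D0] _ _] _ _] := cD.
  by rewrite (D0 erefl) mul0r.
rewrite expgS -natr1 mulrDl mul1r addrC.
apply: le_trans (dist_mul gS (com_fullX ft n gS)) _.
by rewrite lerD2l.
Qed.

Lemma dist_inv S : G S -> D 1%g (S^-1)%g = D 1%g S.
Proof.
move=> gS; have [[_ _ sym _] inv _] := cD.
have g1 := com_full1 ft; have gV := com_fullV ft gS.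
by rewrite -(inv _ _ _ gS g1 gV) mulg1 mulgV sym.
Qed.

(** Modulo the kernel, on which [D 1] is bounded, an element is a power of [T]. *)
Lemma dist_index_le : exists2 C : R, 0 < C &
  forall S, G S -> D 1%g S <= C * `|(I S)%:~R| + C.
Proof.
have [C HC] := kernel_bounded; have gT := com_fullT ft; have g1 := com_full1 ft.
have [[pos _ _ _] _ _] := cD.
have DT0 : 0 <= D 1%g T by exact: pos.
have C0 : 0 <= C by apply: le_trans (HC _ g1 (com_index1 ft et sE)); exact: pos.
exists (1 + D 1%g T + C) => [|S gS]; first by lra.
have [U [gU iU DU]] : exists U, [/\ G U, I U = I S & D 1%g U <= `|(I S)%:~R| * D 1%g T].
  have gX n := com_fullX ft n gT; have iT := com_indexT ft.
  move: (I S) => [n|n].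
    exists (T ^+ n)%g; split=> //; first by rewrite (com_indexX ft et sE _ gT) iT mulr1.
    by rewrite ger0_norm ?ler0z//; exact: dist_expg.
  exists (T ^+ n.+1)^-1%g; split.
  - exact: com_fullV.
  - by rewrite (com_indexV ft et sE)// (com_indexX ft et sE _ gT) iT mulr1 NegzE.
  - rewrite dist_inv// NegzE mulrNz normrN ger0_norm ?ler0z//; exact: dist_expg.
have gV := com_fullV ft gU; have gVS := com_fullM ft gV gS.
have := dist_mul gU gVS; rewrite mulVKg => /le_trans; apply.
have iVS : I (U^-1 * S)%g = 0.
  by rewrite (com_indexM ft et sE gV gS) (com_indexV ft et sE gU) iU addNr.
have := HC _ gVS iVS; have : 0 <= `|(I S)%:~R| :> R by exact: normr_ge0.
move: DU; set a := `|_|; nra.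
Qed.

End Kernel.

Theorem theorem3 (R : realType) (d : measure_display) (X : measurableType d)
    (mu : probability X R) (hX : standard_borel R X) (hmu : atomless mu)
    (T : Aut mu) (hT : ergodic T) :
  quasi_isometry R (com_full_group T) (com_nbhs T) (com_index T).
Proof.
have [E sE] := standard_separating hX.
have et : ergodic_map (repr T) by exact: hT.
have ft := ergodic_free sE hmu et.
have cT := com_dist_compatible ft et sE.
have iT := com_dist_invariant ft et sE.
have mT := com_dist_metric ft sE.
exists (com_dist T).
  split; first by split.
  move=> D cD; have [C C0 HC] := dist_index_le ft et sE hmu cD.
  have [_ inv _] := cD.
  exists C => // g h gg gh; have gV := com_fullV ft gg; have gVh := com_fullM ft gV gh.
  have -> : D g h = D 1%g (g^-1 * h)%g.
    by rewrite -(inv _ _ _ gg (com_full1 ft) gVh) mulg1 mulVKg.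
  apply: le_trans (HC _ gVh) _; rewrite lerD2r ler_pM2l//.
  rewrite (com_indexM ft et sE gV gh) (com_indexV ft et sE gg) /com_dist.
  have := dcut_ge0 T g h.
  move: (com_index T g) (com_index T h) => a b.
  by rewrite addrC norm_intr_sub => ?; rewrite lerDl.
exists 1, 1; split=> // [g h gg gh|n].
  have := dcut_ge0 T g h; have := dcut_le1 T sE g h; rewrite /com_dist -intrB.
  move: (com_index T g) (com_index T h) => a b.
  rewrite invr1 !mul1r; set u := `|_|; lra.
have [S gS iS] := com_index_onto ft et sE n.
by exists S => //; rewrite iS subrr normr0.
Qed.
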